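(* Let $r\in\{1,2,\dots\}$, $0<\delta<1$, $1\le s<\infty$, $\mu>2r-1/s+3/2$, $1\le p\le\infty$. Then for $N\asymp\left(\delta^{-1}\ln^{\mu}\frac1\delta\right)^{\frac{1}{\mu-1/p+1/s}}$ it holds $$N^{-\mu+2r-1/s+3/2}\preceq R^{(r,r)}_{N,\delta}(L^{\mu}_{s,2},C,\ell_p)\preceq N^{-\mu+2r-1/s+3/2}\ln^{\mu-2r+1/2}N$$ or $$\left(\delta\ln^{-\mu}\tfrac1\delta\right)^{\frac{\mu-2r+1/s-3/2}{\mu-1/p+1/s}}\preceq R^{(r,r)}_{N,\delta}(L^{\mu}_{s,2},C,\ell_p)\preceq\left(\delta\ln^{1/s-1/p}\tfrac1\delta\right)^{\frac{\mu-2r+1/s-3/2}{\mu-1/p+1/s}}\ln^{2-1/s}\tfrac1\delta .$$ The upper bound is realized by the hyperbolic-cross truncation method $\mathcal D^{(r,r)}_n$ for $n\asymp\left(\delta^{-1}\ln^{1/p-1/s}\frac1\delta\right)^{\frac{1}{\mu-1/p+1/s}}$.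
   Context: Let $\varphi_k(t)=\sqrt{k+1/2}\,(2^kk!)^{-1}\frac{d^k}{dt^k}[(t^2-1)^k]$, $k=0,1,2,\dots$, be the Legendre polynomials orthonormal on $[-1,1]$, $Q=[-1,1]^2$, $\varphi_{k,j}(t,\tau)=\varphi_k(t)\varphi_j(\tau)$, and $\langle f,\varphi_{k,j}\rangle=\int_{-1}^1\int_{-1}^1 f(t,\tau)\varphi_k(t)\varphi_j(\tau)\,d\tau\,dt$ (Fourier-Legendre coefficients). $C=C(Q)$ is the space of continuous functions on $Q$ with the uniform norm. $\ell_p$ is the space of double sequences $(x_{k,j})_{k,j\ge0}$ with norm $(\sum|x_{k,j}|^p)^{1/p}$ (supremum if $p=\infty$). The space $L^\mu_{s,2}$ consists of $f\in L_2(Q)$ with $\|f\|_{s,\mu}^s:=\sum_{k,j\ge0}(\underline{k\cdot j})^{s\mu}|\langle f,\varphi_{k,j}\rangle|^s<\infty$, where $\underline{m}=\max\{1,m\}$; the class $L^\mu_{s,2}$ is its unit ball $\|f\|_{s,\mu}\le1$. The mixed derivative is understood as the series $f^{(r,r)}(t,\tau)=\sum_{k,j\ge r}\langle f,\varphi_{k,j}\rangle\varphi_k^{(r)}(t)\varphi_j^{(r)}(\tau)$. Perturbed data: a sequence of numbers $\overline{f^\delta}=(\langle f^\delta,\varphi_{k,j}\rangle)_{k,j\ge0}$ is admissible for $f$ at level $\delta$, $0<\delta<1$, if $\|(\langle f-f^\delta,\varphi_{k,j}\rangle)_{k,j\ge0}\|_{\ell_p}\le\delta$. For a finite set $\Omega$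 of integer points of $[r,\infty)\times[r,\infty)$, $G(\Omega,\overline{f^\delta})=(\langle f^\delta,\varphi_{k,j}\rangle)_{(k,j)\in\Omega}$, and $\Psi(\Omega)$ is the set of all mappings $\psi:\mathbb R^{\mathrm{card}(\Omega)}\to C$ (neither linearity nor stability is required). The error of $\psi\in\Psi(\Omega)$ is $$\varepsilon_\delta(L^\mu_{s,2},\psi,C,\ell_p)=\sup_{\|f\|_{s,\mu}\le1}\ \sup_{\overline{f^\delta}\text{ admissible for }f}\|f^{(r,r)}-\psi(G(\Omega,\overline{f^\delta}))\|_C,$$ and the minimal radius of Galerkin information is $R^{(r,r)}_{N,\delta}(L^\mu_{s,2},C,\ell_p)=\inf_{\Omega:\,\mathrm{card}(\Omega)\le N}\ \inf_{\psi\in\Psi(\Omega)}\varepsilon_\delta(L^\mu_{s,2},\psi,C,\ell_p)$. The truncation method is $\mathcal D_n^{(r,r)}f^\delta(t,\tau)=\sum_{k,j\ge r,\ kj\le rn-1}\langle f^\delta,\varphi_{k,j}\rangle\varphi_k^{(r)}(t)\varphi_j^{(r)}(\tau)$. Notation: for positive quantities, $a\preceq b$ means that there is a constant $c>0$ with $a\le cb$, and $a\asymp b$ means $a\preceq b$ and $b\preceq a$; constants may depend only on basic parameters such as $\mu,r,p,s$. $\ln^a x=(\ln x)^a$. *)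

(* Defs.v *)
From HB Require Import structures.
From mathcomp Require Import all_boot all_order all_algebra finmap.
From mathcomp Require Import all_classical all_reals all_analysis.
Set Implicit Arguments.
Unset Strict Implicit.
Unset Printing Implicit Defensive.
Import Order.TTheory GRing.Theory Num.Theory.
Import numFieldNormedType.Exports.

Local Open Scope classical_set_scope.
Local Open Scope fset_scope.
Local Open Scope ring_scope.

Definition legendre (R : realType) (k : nat) : {poly R} :=
  (Num.sqrt (k%:R + 1 / 2) / (2 ^+ k * k`!%:R)) *: (('X^2 - 1) ^+ k)^`(k).

Definition squareQ (R : realType) : set (R * R) :=
  [set z | (-1 <= z.1 <= 1) && (-1 <= z.2 <= 1)].

(* Double sequences are functions on pairs; f is only evaluated on Q. *)
Definition fourier_legendre (R : realType) (f : R * R -> R) (kj : nat * nat)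
    : R :=
  \int[lebesgue_measure]_(t in `[-1, 1])
    \int[lebesgue_measure]_(tau in `[-1, 1])
      (f (t, tau) * (legendre R kj.1).[t] * (legendre R kj.2).[tau]).

Definition supnormQ (R : realType) (g : R * R -> R) : \bar R :=
  ereal_sup [set `|g z|%:E | z in @squareQ R].

Definition lp_norm (R : realType) (p : \bar R) (x : nat * nat -> R) : \bar R :=
  match p with
  | q%:E => poweR (\esum_(kj in [set: nat * nat]) (`|x kj| `^ q)%:E) q^-1
  | _ => ereal_sup [set `|x kj|%:E | kj in [set: nat * nat]]
  end.

Definition smu_norm (R : realType) (s mu : R) (f : R * R -> R) : \bar R :=
  poweR (\esum_(kj in [set: nat * nat])
           ((maxn 1 (kj.1 * kj.2))%:R `^ (s * mu)
            * `|fourier_legendre f kj| `^ s)%:E) s^-1.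

(* f \_ Q is f extended by 0 outside Q, so the first condition is f \in L_2(Q). *)
Definition Lsmu_ball (R : realType) (s mu : R) : set (R * R -> R) :=
  [set f | f \_ (@squareQ R) \in
             Lfun (@lebesgue_measure R \x @lebesgue_measure R)%E 2%:E
           /\ (smu_norm s mu f <= 1)%E].

Definition deriv_basis (R : realType) (r : nat) (kj : nat * nat) (z : R * R)
    : R :=
  (legendre R kj.1)^`(r).[z.1] * (legendre R kj.2)^`(r).[z.2].

(* The double series is summed pointwise, as the limit of its rectangular
   partial sums. *)
Definition mixed_deriv (R : realType) (r : nat) (f : R * R -> R) (z : R * R)
    : R :=
  lim ((fun mn : nat * nat =>
          \sum_(r <= k < mn.1) \sum_(r <= j < mn.2)
            fourier_legendre f (k, j) * deriv_basis r (k, j) z)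
       @ filter_prod \oo \oo).

Definition admissible (R : realType) (p : \bar R) (delta : R)
    (f : R * R -> R) : set (nat * nat -> R) :=
  [set x | (lp_norm p (fun kj => fourier_legendre f kj - x kj)%R
              <= delta%:E)%E].

(* R^card(Omega) is indexed by the points of Omega themselves. *)
Definition galerkin_info (R : realType) (Omega : {fset nat * nat})
    (x : nat * nat -> R) : {ffun Omega -> R} :=
  [ffun w : Omega => x (val w)].

(* An element of C(Q) is represented by any function on the plane whose
   restriction to Q is continuous. *)
Definition recovery_maps (R : realType) (Omega : {fset nat * nat})
    : set ({ffun Omega -> R} -> R * R -> R) :=
  [set psi | forall y, {within @squareQ R, continuous (psi y)}].

Definition recovery_error (R : realType) (r : nat) (s mu : R) (p : \bar R)
    (delta : R) (Omega : {fset nat * nat})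
    (psi : {ffun Omega -> R} -> R * R -> R) : \bar R :=
  ereal_sup
    [set ereal_sup
       [set supnormQ (fun z => mixed_deriv r f z - psi (galerkin_info Omega x) z)
       | x in admissible p delta f]
    | f in Lsmu_ball s mu].

Definition min_radius (R : realType) (r : nat) (s mu : R) (p : \bar R)
    (delta : R) (N : nat) : \bar R :=
  ereal_inf
    [set ereal_inf
       [set recovery_error r s mu p delta psi | psi in @recovery_maps R Omega]
    | Omega in [set Omega : {fset nat * nat} |
        {in Omega, forall kj, (r <= kj.1)%N && (r <= kj.2)%N}
        /\ (#|` Omega| <= N)%N]].

(* Points k, j >= r with kj <= rn - 1. For r >= 1 the ranges of k and j lose no
   point: k, j <= kj < rn. *)
Definition hyp_cross (r n : nat) : {fset nat * nat} :=
  [fset kj | kj in [seq (k, j) | k <- iota r (r * n), j <- iota r (r * n)]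
           & (kj.1 * kj.2 < r * n)%N].

Definition truncation (R : realType) (r n : nat)
    (y : {ffun hyp_cross r n -> R}) (z : R * R) : R :=
  \sum_(w : hyp_cross r n) y w * deriv_basis r (val w) z.

Definition comparable_within (R : realType) (c1 c2 a b : R) : Prop :=
  c1 * b <= a <= c2 * b.

(* Main.v *)
(* Put v = ((X^2 - 1)^k)^(k+m), a multiple of the m-th derivative of the k-th
   Legendre polynomial. It solves the Gegenbauer equation, which yields both
   |v| <= v(1) on [-1, 1] and the value v(1); hence phi_k^(r) is bounded on
   [-1, 1] by its value at 1, which is of the order of k^(2r + 1/2).

   Upper bounds. The error of the truncation method splits into the tail
   kj >= rn and the propagated noise on kj < rn. Both are sums of |x_kj| (kj)^g
   under an l_s or l_p constraint. Instead of Hoelder's inequality we use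
   x <= t + x^s t^(1-s) with t a power of kj: this is off by a power of a
   logarithm, which the claimed bounds leave room for, and reduces everything to
   the sums of (kj)^(-1-a) over kj >= rn and the number of points of the cross.

   Lower bounds. Among the points (k, r) with k in [r + N, r + 3N) at least N
   avoid Omega. The function whose Fourier-Legendre coefficients are equal there
   and vanish elsewhere, and its opposite, are compatible with zero data, while
   all phi_k^(r)(1) are positive, so that its derivative is large at (1, 1). *)
Require Import Defs.
From HB Require Import structures.
From mathcomp Require Import all_boot all_order all_algebra finmap.
From mathcomp Require Import all_classical all_reals all_analysis.
From mathcomp Require Import measurable_realfun.
From mathcomp Require Import ring lra.
Set Implicit Arguments.
Unset Strict Implicit.
Unset Printing Implicit Defensive.
Import Order.TTheory GRing.Theory Num.Theory.
Import numFieldNormedType.Exports.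
Local Open Scope classical_set_scope.
Local Open Scope fset_scope.
Local Open Scope ring_scope.

(** * Legendre polynomials and their derivatives *)

Section LegendrePolynomials.
Variable R : realType.
Implicit Types (k m n r : nat) (t x : R) (p q u : {poly R}).

Definition rodrigues k : {poly R} := ('X^2 - 1) ^+ k.

Lemma rodriguesS k : rodrigues k.+1 = ('X^2 - 1) * rodrigues k.
Proof. by rewrite /rodrigues exprS. Qed.

Lemma deriv_rodriguesS k :
  (rodrigues k.+1)^`() = (2 * k.+1%:R)%:P * ('X * rodrigues k).
Proof.
rewrite /rodrigues deriv_exp derivB derivXn derivC subr0 /=.
by rewrite -mulr_natl polyCM !polyC_natr; ring.
Qed.

Lemma rodrigues_ode0 k :
  ('X^2 - 1) * (rodrigues k)^`() = (2 * k%:R)%:P * ('X * rodrigues k).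
Proof.
case: k => [|k]; first by rewrite /rodrigues expr0 derivC !mulr0 mul0r.
by rewrite deriv_rodriguesS rodriguesS; ring.
Qed.

(** Differentiation keeps the shape of the equation and only shifts its coefficients, so
    [rodrigues_ode] follows by induction on the order. *)
Lemma deriv_ode (a b : R) u :
  ('X^2 - 1) * u^`()^`() + a%:P * ('X * u^`()) + b%:P * u = 0 ->
  ('X^2 - 1) * u^`()^`()^`() + (a + 2)%:P * ('X * u^`()^`())
    + (a + b)%:P * u^`() = 0.
Proof.
move=> /(congr1 (@deriv R)); rewrite !derivD !deriv_mulC !derivM derivX derivB.
rewrite derivXn derivC deriv0 subr0 /= => E.
by rewrite -[RHS]E !polyCD !polyC1; ring.
Qed.

Lemma rodrigues_ode k n :
  ('X^2 - 1) * (rodrigues k)^`(n.+2)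
  + (2 * (n.+1%:R - k%:R))%:P * ('X * (rodrigues k)^`(n.+1))
  + (n.+1%:R * (n%:R - 2 * k%:R))%:P * (rodrigues k)^`(n) = 0.
Proof.
elim: n => [|n IHn].
  (* The base case is the derivative of the first-order equation of (X^2 - 1)^k. *)
  have /(congr1 (@deriv R)) := rodrigues_ode0 k.
  rewrite deriv_mulC !derivM derivX derivB derivXn derivC subr0 /= => E.
  move/eqP: E; rewrite -subr_eq0 => /eqP E; rewrite -[RHS]E.
  rewrite !(polyCM, polyCB, polyC_natr, polyC1, polyC0).
  by ring.
have := deriv_ode IHn; rewrite -!derivnS => <-.
by congr (_ + _%:P * _ + _%:P * _); rewrite -!natr1; ring.
Qed.

(** At order k + m the coefficients become 2(m + 1) and (k + m + 1)(m - k): this is the Gegenbauer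
    equation. *)
Lemma rodrigues_odeE k m t : let v := (rodrigues k)^`(k + m) in
  (t ^+ 2 - 1) * v^`()^`().[t] + 2 * m.+1%:R * t * v^`().[t]
  = (k%:R - m%:R) * (k%:R + m%:R + 1) * v.[t].
Proof.
move=> /=; have /(congr1 (fun p => p.[t])) := rodrigues_ode k (k + m).
rewrite !derivnS !(hornerD, hornerN, hornerM, hornerC, hornerX, hornerXn) => E.
by apply/eqP; rewrite -subr_eq0 -[X in _ == X]E -!natr1 natrD; apply/eqP; ring.
Qed.

Lemma derivnMX p n :
  ('X * p)^`(n) = n%:R *: p^`(n.-1) + 'X * p^`(n).
Proof.
case: n => [|n]; first by rewrite !derivn0 scale0r add0r.
have := derivnMXaddC n p 0; rewrite addr0 mulrC scaler_nat => ->.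
by rewrite [_ * 'X]mulrC.
Qed.

(** (X^2 - 1)^k has zeros of order k at 1 and at -1, both covered by x^2 = 1; this removes the
    boundary terms in the integrations by parts below. *)
Lemma horner_rodrigues_lt k n x : x ^+ 2 = 1 -> (n < k)%N ->
  (rodrigues k)^`(n).[x] = 0.
Proof.
move=> x1; elim: k n => // k IHk [|n] nk.
  by rewrite derivn0 rodriguesS !hornerE x1 subrr mul0r.
rewrite derivSn deriv_rodriguesS mul_polyC derivnZ derivnMX !hornerE.
rewrite (IHk n) // mulr0 addr0; case: n nk => [|n] nk; first by rewrite mul0r mulr0.
by rewrite /= IHk ?mulr0 // ltnW.
Qed.

Lemma rodrigues_diag1 k : (rodrigues k)^`(k).[1] = 2 ^+ k * k`!%:R.
Proof.
elim: k => [|k IHk]; first by rewrite derivn0 /rodrigues expr0 hornerC mulr1.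
rewrite derivSn deriv_rodriguesS mul_polyC derivnZ derivnMX !hornerE IHk.
rewrite factS natrM exprS.
case: k {IHk} => [|k]; first by ring.
by rewrite horner_rodrigues_lt ?expr1n //; ring.
Qed.

(** At t = 1 the leading term of the Gegenbauer equation vanishes, which leaves a recursion in m. *)
Lemma rodrigues_at1 k m : 2 * m.+1%:R * (rodrigues k)^`(k + m.+1).[1]
  = (k%:R - m%:R) * (k%:R + m%:R + 1) * (rodrigues k)^`(k + m).[1].
Proof.
by rewrite -rodrigues_odeE expr1n subrr mul0r add0r mulr1 addnS derivnS.
Qed.

Lemma rodrigues_at1_gt0 k m : (m <= k)%N -> 0 < (rodrigues k)^`(k + m).[1].
Proof.
elim: m => [_|m IHm mk].
  by rewrite addn0 rodrigues_diag1 mulr_gt0 ?exprn_gt0 ?ltr0n ?fact_gt0.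
have c0 : 0 < 2 * m.+1%:R :> R by rewrite mulr_gt0 ?ltr0n.
by rewrite -(pmulr_rgt0 _ c0) rodrigues_at1 !mulr_gt0 ?IHm ?(ltnW mk) // subr_gt0 ltr_nat.
Qed.

(** The polynomial is even and each derivative flips the parity; this reduces [rodrigues_max] to t
    >= 0. *)
Lemma rodrigues_parity k n x :
  (rodrigues k)^`(n).[- x] = (-1) ^+ n * (rodrigues k)^`(n).[x].
Proof.
have -> : (rodrigues k)^`(n).[- x] = ((rodrigues k)^`(n) \Po (- 'X)).[x].
  by rewrite horner_comp !hornerE.
suff -> : (rodrigues k)^`(n) \Po (- 'X) = ((-1) ^+ n)%:P * (rodrigues k)^`(n).
  by rewrite !hornerE.
elim: n => [|n IHn].
  rewrite derivn0 mul1r /rodrigues rmorphXn /= rmorphB /= rmorphXn /= comp_polyX.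
  by rewrite comp_polyC sqrrN.
have /(congr1 (@deriv R)) := IHn.
rewrite deriv_comp deriv_mulC derivN derivX -derivnS => E.
by rewrite exprS mulN1r polyCN mulNr -E mulrN1 opprK.
Qed.

Lemma size_rodrigues k : size (rodrigues k) = (k.*2).+1.
Proof.
have s3 : size ('X^2 - 1 : {poly R}) = 3%N by rewrite -polyC1 size_XnsubC.
have := size_exp ('X^2 - 1 : {poly R}) k; rewrite s3 mul2n => <-.
by rewrite prednK // lt0n size_poly_eq0 expf_neq0 // -size_poly_eq0 s3.
Qed.

(* The Lyapunov function l u^2 + (1 - t^2) u'^2 of the differential equation is
   nondecreasing in |t|. *)
Lemma ode_sq_le_at1 (a l : R) u t : 1 / 2 <= a -> 0 < l ->
  (forall x, (x ^+ 2 - 1) * u^`()^`().[x] + 2 * a * x * u^`().[x] = l * u.[x]) ->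
  0 <= t <= 1 -> u.[t] ^+ 2 <= u.[1] ^+ 2.
Proof.
move=> a2 l0 ode /andP[t0 t1].
pose F := l%:P * u ^+ 2 + (1 - 'X^2) * u^`() ^+ 2.
have dF x : F^`().[x] = (4 * a - 2) * x * u^`().[x] ^+ 2.
  rewrite /F derivD deriv_mulC derivM !expr2 !derivM derivB derivC derivM derivX.
  rewrite !(hornerD, hornerN, hornerM, hornerC, hornerX, hornerXn).
  have /eqP := ode x; rewrite -subr_eq0 => /eqP E.
  apply/eqP; rewrite -subr_eq0; apply/eqP.
  (* The difference of the two sides is -2u' times the differential equation. *)
  rewrite -[RHS](mulr0 (-2 * u^`().[x])) -[in RHS]E.
  by ring.
have F01 : F.[t] <= F.[1].
  have [c c01 Fc] := MVT_segment t1 (fun x _ => is_derive_poly F x)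
    (continuous_subspaceT (@continuous_horner _ F)).
  have /andP[tc _] : t <= c <= 1 by move: c01; rewrite in_itv.
  rewrite -subr_ge0 Fc dF mulr_ge0 ?subr_ge0 // mulr_ge0 ?sqr_ge0 // mulr_ge0 //.
    by move: a2; lra.
  exact: le_trans tc.
(* The derivative term of F is nonnegative at t and vanishes at 1. *)
have : l * u.[t] ^+ 2 <= l * u.[1] ^+ 2.
  apply: le_trans (_ : F.[t] <= _).
    rewrite /F !(hornerD, hornerN, hornerM, hornerC, hornerX, hornerXn, horner_exp).
    by rewrite -!expr2 lerDl mulr_ge0 ?sqr_ge0 // subr_ge0 expr_le1.
  apply: (le_trans F01).
  rewrite /F !(hornerD, hornerN, hornerM, hornerC, hornerX, hornerXn, horner_exp).
  by rewrite -!expr2 expr1n subrr mul0r addr0.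
by rewrite ler_pM2l.
Qed.

Lemma rodrigues_max k m t : (m <= k)%N -> -1 <= t <= 1 ->
  `|(rodrigues k)^`(k + m).[t]| <= (rodrigues k)^`(k + m).[1].
Proof.
move=> mk t1; have y1 := rodrigues_at1_gt0 mk.
rewrite -(ger0_norm (ltW y1)) -ler_sqr ?nnegrE ?normr_ge0 // !real_normK ?num_real //.
(* For m = k the coefficient (k - m)(k + m + 1) is zero and the Lyapunov argument breaks down; but
   then the derivative has order 2k, the degree of the polynomial, and is constant. *)
have [mk'|/negbTE mk'] := boolP (m < k)%N; last first.
  have km : (k <= m)%N by rewrite leqNgt mk'.
  have {km mk mk'} -> : m = k by apply/eqP; rewrite eqn_leq mk km.
  have s : (size (rodrigues k)^`(k + k) <= 1)%N.
    apply/leq_sizeP => j j0; rewrite coef_derivn nth_default ?mul0rn //.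
    by rewrite size_rodrigues -addnn -addn1 leq_add2l.
  by rewrite (size1_polyC s) !hornerC.
wlog t0 : t t1 / 0 <= t.
  move=> H; have [/H|t0] := leP 0 t; first exact.
  rewrite -[t]opprK rodrigues_parity exprMn -exprM mulnC exprM sqrrN !expr1n mul1r.
  by apply: H; [lra|rewrite oppr_ge0 ltW].
apply: (@ode_sq_le_at1 m.+1%:R ((k%:R - m%:R) * (k%:R + m%:R + 1))).
- by have : 1 <= m.+1%:R :> R; [rewrite ler1n|lra].
- by rewrite mulr_gt0 ?subr_gt0 ?ltr_nat // ltr_wpDl ?addr_ge0.
- by move=> x; exact: rodrigues_odeE.
- by rewrite t0; case/andP: t1.
Qed.

(** Each factor (k - m)(k + m + 1) / (2(m + 1)) of the recursion [rodrigues_at1] lies between k^2 /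
    (2(m + 1)^2) and k^2, because m + 1 <= k gives k - m >= k / (m + 1). *)
Lemma rodrigues_at1_bounds k m : (m <= k)%N ->
  2 ^+ k * k`!%:R * (k%:R ^+ (2 * m)) / \prod_(i < m) (2 * i.+1%:R ^+ 2)
  <= (rodrigues k)^`(k + m).[1] <= 2 ^+ k * k`!%:R * k%:R ^+ (2 * m).
Proof.
elim: m => [_|m IHm mk]; first by rewrite addn0 rodrigues_diag1 big_ord0 mulr1 divr1 lexx.
have /andP[IHl IHu] := IHm (ltnW mk).
have E := rodrigues_at1 k m.
have {}E : (rodrigues k)^`(k + m.+1).[1]
   = (k%:R - m%:R) * (k%:R + m%:R + 1) / (2 * m.+1%:R)
   * (rodrigues k)^`(k + m).[1].
  by rewrite mulrAC -E mulrC mulKf // mulf_neq0 ?pnatr_eq0.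
rewrite E big_ord_recr /= mulnS exprD invfM.
have m1 : 1 <= m.+1%:R :> R by rewrite ler1n.
have km : m.+1%:R <= k%:R :> R by rewrite ler_nat.
have mE : m%:R = m.+1%:R - 1 :> R by rewrite -natr1 addrK.
have m0 : 0 < 2 * m.+1%:R :> R by rewrite mulr_gt0 ?ltr0n.
have y0 := rodrigues_at1_gt0 (ltnW mk).
set M := m.+1%:R in m1 km mE m0 *; set K := k%:R in km *; set y := _.[1] in IHl IHu y0 *.
have M0 : 0 < M by rewrite /M ltr0n.
apply/andP; split.
  have -> : 2 ^+ k * k`!%:R * (K ^+ 2 * K ^+ (2 * m))
      * ((\prod_(i < m) (2 * i.+1%:R ^+ 2))^-1 * (2 * M ^+ 2)^-1)
    = K ^+ 2 / (2 * M ^+ 2)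
      * (2 ^+ k * k`!%:R * K ^+ (2 * m) / \prod_(i < m) (2 * i.+1%:R ^+ 2)) by ring.
  apply: ler_pM => //.
  - by rewrite divr_ge0 ?mulr_ge0 ?sqr_ge0.
  - rewrite divr_ge0 ?mulr_ge0 ?exprn_ge0 ?ler0n // prodr_ge0 // => i _.
  - have -> : K ^+ 2 / (2 * M ^+ 2) = K / M * K / (2 * M).
      by field; rewrite gt_eqF.
    rewrite ler_pM2r ?invr_gt0 // ler_pM ?divr_ge0 ?ler0n //; last by rewrite mE; lra.
    by rewrite ler_pdivrMr // mE; nra.
have -> : 2 ^+ k * k`!%:R * (K ^+ 2 * K ^+ (2 * m)) =
    K ^+ 2 * (2 ^+ k * k`!%:R * K ^+ (2 * m)) by ring.
apply: (ler_pM _ (ltW y0) _ IHu).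
- by rewrite divr_ge0 ?mulr_ge0 ?(ltW m0) //; rewrite ?mE; lra.
- by rewrite ler_pdivrMr // mE; nra.
Qed.

Lemma derivn_legendre k r : (legendre R k)^`(r) =
  (Num.sqrt (k%:R + 1 / 2) / (2 ^+ k * k`!%:R)) *: (rodrigues k)^`(k + r).
Proof.
by rewrite /legendre derivnZ /derivn -iterD addnC.
Qed.

Lemma legendre_max k r t : (r <= k)%N -> -1 <= t <= 1 ->
  `|(legendre R k)^`(r).[t]| <= (legendre R k)^`(r).[1].
Proof.
move=> rk t1; rewrite derivn_legendre !hornerZ normrM ger0_norm; last first.
  by rewrite divr_ge0 ?sqrtr_ge0 ?mulr_ge0 ?exprn_ge0.
by rewrite ler_wpM2l ?rodrigues_max // divr_ge0 ?sqrtr_ge0 ?mulr_ge0 ?exprn_ge0.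
Qed.

(** The factor 2^k k! of [rodrigues_at1_bounds] cancels against the normalisation, and sqrt(k + 1/2)
    lies between sqrt(k) and 2 sqrt(k). *)
Lemma legendre_at1_bounds r : exists2 c : R, 0 < c & forall k, (1 <= r <= k)%N ->
  c * k%:R `^ ((2 * r)%:R + 1 / 2) <= (legendre R k)^`(r).[1]
  <= 2 * k%:R `^ ((2 * r)%:R + 1 / 2).
Proof.
exists (\prod_(i < r) (2 * i.+1%:R ^+ 2))^-1.
  by rewrite invr_gt0 prodr_gt0 // => i _; rewrite mulr_gt0 ?exprn_gt0.
move=> k /andP[r1 rk]; rewrite derivn_legendre hornerZ.
have /andP[] := rodrigues_at1_bounds rk.
have k0 : 0 < k%:R :> R by rewrite ltr0n (leq_trans r1).
have f0 : 0 < 2 ^+ k * k`!%:R :> R by rewrite mulr_gt0 ?exprn_gt0 ?ltr0n ?fact_gt0.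
rewrite powRD ?pnatr_eq0 ?implybT //;
  last by rewrite -lt0n (leq_trans r1) ?implybT.
rewrite powR_mulrn ?(ltW k0) // div1r powR12_sqrt ?(ltW k0) //.
set f := _ * _ in f0 *; set y := _.[1]; set P := (\prod_(i < r) _)^-1.
have : Num.sqrt (k%:R : R) <= Num.sqrt (k%:R + 2^-1) <= 2 * Num.sqrt (k%:R : R).
  have -> : 2 * Num.sqrt k%:R = Num.sqrt (4 * k%:R) :> R.
    rewrite sqrtrM // (_ : 4 = 2 ^+ 2) ?sqrtr_sqr ?ger0_norm //.
    by rewrite -natrX.
  have : 1 <= k%:R :> R by rewrite ler1n (leq_trans r1).
  by move=> ?; apply/andP; split; rewrite ler_sqrt; lra.
set S := Num.sqrt k%:R; set S' := Num.sqrt _ => /andP[S1 S2] l1 l2.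
have S0 : 0 <= S by exact: sqrtr_ge0.
rewrite mulrAC ler_pdivlMr // ler_pdivrMr //.
have P0 : 0 <= P.
  by rewrite invr_ge0 prodr_ge0 // => i _; rewrite mulr_ge0 ?sqr_ge0.
have fKP0 : 0 <= f * k%:R ^+ (2 * r) * P by rewrite !mulr_ge0 ?exprn_ge0 // ltW.
apply/andP; split.
  apply: (@le_trans _ _ (S * (f * k%:R ^+ (2 * r) * P))); first by lra.
  exact: ler_pM.
apply: (@le_trans _ _ (2 * S * (f * k%:R ^+ (2 * r)))); last by lra.
apply: ler_pM => //; first exact: le_trans S1.
exact: le_trans l1.
Qed.

End LegendrePolynomials.

(** * Orthogonality *)

Section LegendreOrthogonality.
Variable R : realType.
Implicit Types (k j n : nat) (t x a : R) (p q : {poly R}).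
Local Notation leb := (@lebesgue_measure R).

Definition integ p : R := \int[leb]_(t in `[-1, 1]) p.[t].

Lemma integrable_horner p : leb.-integrable `[-1, 1] (EFin \o horner p).
Proof.
apply: continuous_compact_integrable; first exact: segment_compact.
exact/continuous_subspaceT/continuous_horner.
Qed.

Lemma integ_deriv p : integ p^`() = p.[1] - p.[-1].
Proof.
have l : (-1 : R) < 1 by lra.
rewrite /integ /Rintegral (@continuous_FTC2 _ _ (horner p) _ _ l) //.
- exact/continuous_subspaceT/continuous_horner.
- split.
  + by move=> x _; exact: derivable_horner.
  + by apply: cvg_at_right_filter; exact: continuous_horner.
  + by apply: cvg_at_left_filter; exact: continuous_horner.
- by move=> x _; rewrite derivE.
Qed.

Lemma integD p q : integ (p + q) = integ p + integ q.
Proof.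
rewrite /integ -RintegralD //; [|exact: integrable_horner..].
by apply: eq_Rintegral => x _; rewrite hornerD.
Qed.

Lemma integZ a p : integ (a *: p) = a * integ p.
Proof.
rewrite /integ -RintegralZl //; last exact: integrable_horner.
by apply: eq_Rintegral => x _; rewrite hornerZ.
Qed.

Lemma integ_sum (I : Type) (s : seq I) (P : pred I) (F : I -> {poly R}) :
  integ (\sum_(i <- s | P i) F i) = \sum_(i <- s | P i) integ (F i).
Proof.
apply: (big_morph integ integD).
by rewrite -[0](scale0r 0) integZ mul0r.
Qed.

Lemma integ_by_parts p q :
  integ (p^`() * q) = (p * q).[1] - (p * q).[-1] - integ (p * q^`()).
Proof. by rewrite -integ_deriv derivM integD addrK. Qed.

(** Integration by parts i times; every boundary term contains a derivative of order below k and
    vanishes by [horner_rodrigues_lt]. *)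
Lemma integ_rodrigues k q i : (i <= k)%N ->
  integ ((rodrigues R k)^`(k) * q)
  = (-1) ^+ i * integ ((rodrigues R k)^`(k - i) * q^`(i)).
Proof.
elim: i => [|i IHi] ik; first by rewrite subn0 derivn0 mul1r.
have lk : (k - i.+1 < k)%N by rewrite -subn_gt0 subKn.
rewrite IHi ?(ltnW ik) // -(@subnSK i k) // derivnS integ_by_parts.
rewrite !hornerM !horner_rodrigues_lt ?sqrrN ?expr1n //.
by rewrite !mul0r subrr sub0r -derivnS exprS mulrN -mulN1r mulrA.
Qed.

(** With I_k the integral of (1 - t^2)^k, integration by parts against 1 = X' gives (2k + 3) I_(k+1)
    = 2(k + 1) I_k. *)
Lemma integ_weight_gt0 k : 0 < (-1) ^+ k * integ (rodrigues R k).
Proof.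
elim: k => [|k IHk].
  by rewrite mul1r /rodrigues expr0 -derivX integ_deriv !hornerX; lra.
have E : integ (rodrigues R k.+1)
    = - (2 * k.+1%:R) * (integ (rodrigues R k.+1) + integ (rodrigues R k)).
  rewrite -[X in integ X = _]mul1r -derivX integ_by_parts !hornerM.
  have z x : x ^+ 2 = 1 -> (rodrigues R k.+1).[x] = 0.
    by move=> x1; rewrite -(derivn0 (rodrigues R k.+1)) horner_rodrigues_lt.
  rewrite !z ?sqrrN ?expr1n // !mulr0 subrr sub0r mulNr; congr (- _).
  rewrite -integD -integZ deriv_rodriguesS rodriguesS -mul_polyC; congr integ.
  by ring.
have {}E : (2 * k.+1%:R + 1) * ((-1) ^+ k.+1 * integ (rodrigues R k.+1))
    = 2 * k.+1%:R * ((-1) ^+ k * integ (rodrigues R k)).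
  rewrite exprS mulrDl mul1r.
  transitivity ((-1) ^+ k * (- (2 * k.+1%:R) * integ (rodrigues R k.+1)
    - integ (rodrigues R k.+1))); first by ring.
  by rewrite {2}E; ring.
have c0 : 0 < 2 * k.+1%:R + 1 :> R by rewrite ltr_wpDl ?mulr_ge0.
by rewrite -(pmulr_rgt0 _ c0) E mulr_gt0 // mulr_gt0 // ltr0n.
Qed.

Lemma size_legendre k : (size (legendre R k) <= k.+1)%N.
Proof.
rewrite -[legendre R k](derivn0) derivn_legendre addn0.
apply: leq_trans (size_scale_leq _ _) _.
apply/leq_sizeP => j kj; rewrite coef_derivn nth_default ?mul0rn //.
by rewrite size_rodrigues -addnn -addnS leq_add2l.
Qed.

Lemma legendreE k : legendre R k =
  (Num.sqrt (k%:R + 1 / 2) / (2 ^+ k * k`!%:R)) *: (rodrigues R k)^`(k).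
Proof. by rewrite -[LHS]derivn0 derivn_legendre addn0. Qed.

(** If j < k, all k derivatives are moved onto a polynomial of degree at most j, which they
    annihilate. *)
Lemma legendre_orthogonal k j : k != j ->
  integ (legendre R k * legendre R j) = 0.
Proof.
wlog jk : k j / (j < k)%N => [H kj|_].
  move: (kj); rewrite neq_ltn => /orP[|] lt; last exact: H.
  by rewrite mulrC; apply: H; rewrite // eq_sym.
rewrite legendreE -scalerAl integZ (integ_rodrigues _ (leqnn k)) //.
rewrite (derivn_poly0 (n := k)).
  by rewrite mulr0 -[0](scale0r 0) integZ mul0r !mulr0.
exact: leq_trans (size_legendre j) jk.
Qed.

(** Moving k derivatives across leaves (-1)^k (X^2 - 1)^k times a derivative of order 2k, a constant
    whose value is read off at 1. The positivity allows [dual_legendre] to divide by this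
    integral. *)
Lemma legendre_sq_gt0 k : 0 < integ (legendre R k * legendre R k).
Proof.
have c0 : 0 < Num.sqrt (k%:R + 1 / 2) / (2 ^+ k * k`!%:R) :> R.
  rewrite divr_gt0 ?sqrtr_gt0 ?mulr_gt0 ?exprn_gt0 ?ltr0n ?fact_gt0 //.
rewrite legendreE -scalerAl -scalerAr !integZ !pmulr_rgt0 //.
rewrite (integ_rodrigues _ (leqnn k)).
rewrite subnn derivn0 /derivn -iterD -/(derivn _ _).
have s : (size (rodrigues R k)^`(k + k) <= 1)%N.
  apply/leq_sizeP => j j0; rewrite coef_derivn nth_default ?mul0rn //.
  by rewrite size_rodrigues -addnn -addn1 leq_add2l.
have := rodrigues_at1_gt0 R (leqnn k).
rewrite (size1_polyC s) hornerC [X in integ X]mulrC mul_polyC integZ => a0.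
by rewrite mulrCA mulr_gt0 // integ_weight_gt0.
Qed.

Lemma fourier_legendre_prod p q kj :
  fourier_legendre (fun z => p.[z.1] * q.[z.2]) kj
  = integ (p * legendre R kj.1) * integ (q * legendre R kj.2).
Proof.
rewrite /fourier_legendre /integ -RintegralZr //; last exact: integrable_horner.
apply: eq_Rintegral => t _ /=.
rewrite -RintegralZl //; last exact: integrable_horner.
by apply: eq_Rintegral => x _ /=; rewrite !hornerM; ring.
Qed.

Lemma horner_bounded p : exists M : R, 0 <= M /\ forall t, -1 <= t <= 1 -> `|p.[t]| <= M.
Proof.
exists (\sum_(i < size p) `|p`_i|); split; first exact: sumr_ge0.
move=> t t1; rewrite horner_coef (le_trans (ler_norm_sum _ _ _)) //.
apply: ler_sum => i _; rewrite normrM ler_piMr // normrX exprn_ile1 //.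
by rewrite ler_norml.
Qed.

Lemma squareQE : @squareQ R = (`[-1, 1] `*` `[-1, 1])%classic.
Proof.
apply/seteqP; split => -[x y]; rewrite /squareQ /= !in_itv /=.
  by move/andP.
by move=> [-> ->].
Qed.

(** The product is bounded on Q, so its square is dominated by a multiple of the indicator of Q, a
    set of finite measure. *)
Lemma prod_Lfun2 p q :
  ((fun z : R * R => p.[z.1] * q.[z.2]) \_ (@squareQ R))%classic
  \in Lfun (leb \x leb)%E 2%:E.
Proof.
pose f (z : R * R) := p.[z.1] * q.[z.2]; rewrite -[X in patch _ _ X]/f.
have mQ : measurable (@squareQ R).
  by rewrite squareQE; apply: measurableX.
have mf : measurable_fun setT f.
  apply: measurable_funM.
    apply: (@measurableT_comp _ _ _ _ _ _ (horner p) _ fst).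
      exact: measurable_poly.
    exact: measurable_fst.
  apply: (@measurableT_comp _ _ _ _ _ _ (horner q) _ snd).
    exact: measurable_poly.
  exact: measurable_snd.
have mfQ : measurable_fun setT (patch (fun=> 0) (@squareQ R) f).
  by apply/(measurable_restrictT f mQ); exact: measurable_funTS.
apply/andP; split; rewrite inE //=.
rewrite /finite_norm unlock /=; apply: poweR_lty.
have [Mp [Mp0 hp]] := horner_bounded p.
have [Mq [Mq0 hq]] := horner_bounded q.
set M := Mp * Mq.
apply: (@le_lt_trans _ _
    (\int[(leb \x leb)%E]_z (((M ^+ 2)%:E * (\1_(@squareQ R) z)%:E)))%E).
  apply: ge0_le_integral => //=.
  - apply/measurable_EFinP.
    apply: (@measurableT_comp _ _ _ _ _ _ (fun x : R => x `^ 2) _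
      (Num.norm \o patch (fun=> 0) (@squareQ R) f)).
      exact: measurable_powR.
    exact: measurableT_comp.
  - by apply/measurable_EFinP; apply: measurable_funM.
  move=> z _; rewrite patchE; case: ifPn => zQ; last first.
    by rewrite normr0 powR0 // mule_ge0 ?lee_fin ?sqr_ge0.
  rewrite -EFinM lee_fin indicE zQ mulr1 powR_mulrn // ler_sqr ?nnegrE ?mulr_ge0 //.
  have [z1 z2] : -1 <= z.1 <= 1 /\ -1 <= z.2 <= 1.
    by move: zQ; rewrite inE /squareQ => /andP.
  by rewrite normrM ler_pM // ?hp ?hq.
rewrite ge0_integralZl //; last 2 first.
- exact/measurable_EFinP.
- by rewrite lee_fin sqr_ge0.
rewrite integral_indic // setIT lte_mul_pinfty ?lee_fin ?sqr_ge0 //.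
pose I : set R := `[-1, 1]%classic.
suff : ((leb \x leb) (@squareQ R) < +oo)%E by [].
rewrite squareQE (_ : (leb \x leb)%E _ = leb I * leb I)%E.
  by rewrite /I lebesgue_measure_itv /=; case: ifP => _; rewrite -?EFinB -EFinM ltry.
exact: product_measure1E.
Qed.

End LegendreOrthogonality.

(** * Sums over hyperbolic crosses *)

Section HyperbolicSums.
Variable R : realType.
Implicit Types (k j n m M : nat) (x a : R).

Lemma powR_addp x a (b : R) : 0 < x -> x `^ (a + b) = x `^ a * x `^ b.
Proof. by move=> x0; rewrite powRD // (gt_eqF x0) implybT. Qed.

Lemma powR_le x (y a : R) : 0 <= a -> 0 <= x -> x <= y -> x `^ a <= y `^ a.
Proof.
move=> a0 x0 xy.
by apply: ge0_ler_powR => //; rewrite nnegrE // (le_trans x0).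
Qed.

(** This is ln(1 + x) <= x at x = -1 / (n + 1). *)
Lemma ln_succ_ge n : (0 < n)%N -> n.+1%:R^-1 <= ln (n.+1%:R) - ln n%:R :> R.
Proof.
move=> n0; have n0' : 0 < n%:R :> R by rewrite ltr0n.
have n1 : 0 < n.+1%:R :> R by rewrite ltr0n.
have := le_ln1Dx (x := n%:R / n.+1%:R - 1 : R).
rewrite [X in ln X]addrC subrK ltrBrDr addNr divr_gt0 // => /(_ isT).
rewrite ln_div ?posrE // -[in X in X -> _]natr1 => h.
have : n%:R / n.+1%:R - 1 = - n.+1%:R^-1 :> R.
  by rewrite -natr1; field; rewrite natr1 gt_eqF.
by move: h; rewrite -!natr1; lra.
Qed.

Lemma harmonic_le n : (0 < n)%N -> \sum_(1 <= k < n) k%:R^-1 <= 1 + ln n%:R :> R.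
Proof.
have H m : \sum_(1 <= k < m.+2) k%:R^-1 <= 1 + ln m.+1%:R :> R.
  elim: m => [|m IHm]; first by rewrite big_nat1 invr1 ln1 addr0.
  rewrite big_nat_recr //=; apply: le_trans (lerD IHm (@ln_succ_ge m.+1 isT)) _.
  by rewrite -addrA lerD2l subrKC.
case: n => [//|[|n]] _; first by rewrite big_geq // ln1 addr0.
by apply: le_trans (H n) _; rewrite lerD2l ler_ln ?posrE ?ltr0n ?ler_nat.
Qed.

(** By e^u >= 1 + u and [ln_succ_ge] the difference is at least a (j + 1)^(-1-a); passing from j + 1
    <= 2j back to j costs 2^(1+a). *)
Lemma powR_telescope a j : 0 < a -> (0 < j)%N ->
  j%:R `^ (- (1 + a)) <=
  2 `^ (1 + a) / a * (j%:R `^ (- a) - j.+1%:R `^ (- a)).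
Proof.
move=> a0 j0; have j0' : 0 < j%:R :> R by rewrite ltr0n.
have j1 : 0 < j.+1%:R :> R by rewrite ltr0n.
have E : j.+1%:R `^ (- a) * (a / j.+1%:R) <= j%:R `^ (- a) - j.+1%:R `^ (- a).
  have -> : j%:R `^ (- a) = j.+1%:R `^ (- a) * expR (a * (ln j.+1%:R - ln j%:R)).
    rewrite /powR !gt_eqF // -expRD; congr expR; ring.
  rewrite -[X in _ - X]mulr1 -mulrBr ler_wpM2l ?powR_ge0 //.
  rewrite lerBrDl; apply: le_trans (expR_ge1Dx _).
  by rewrite lerD2l ler_pM2l // ln_succ_ge.
apply: le_trans (_ : 2 `^ (1 + a) / a * (j.+1%:R `^ (- a) * (a / j.+1%:R)) <= _);
  last by rewrite ler_wpM2l // divr_ge0 ?powR_ge0 ?ltW.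
have -> : 2 `^ (1 + a) / a * (j.+1%:R `^ (- a) * (a / j.+1%:R))
    = 2 `^ (1 + a) * (j.+1%:R `^ (- (1 + a))).
  rewrite opprD [-1 - a]addrC (powR_addp _ _ j1).
  by rewrite powR_inv1 ?(ltW j1) //; field; rewrite !gt_eqF.
rewrite !powRN -ler_pdivrMr ?powR_gt0 ?invr_gt0 ?powR_gt0 // invrK.
rewrite mulrC ler_pdivrMr ?powR_gt0 // -powRM ?(ltW j0') //.
apply: ge0_ler_powR; rewrite ?nnegrE ?mulr_ge0 ?(ltW j0') //; first lra.
by rewrite -natr1 mulrDl mul1r lerD2l ler1n.
Qed.

Lemma power_tail_le a n M : 0 < a -> (0 < n)%N ->
  \sum_(n <= j < M) j%:R `^ (- (1 + a)) <= 2 `^ (1 + a) / a * n%:R `^ (- a).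
Proof.
move=> a0 n0; have C0 : 0 <= 2 `^ (1 + a) / a by rewrite divr_ge0 ?powR_ge0 ?ltW.
have [nM|Mn] := leqP n M; last first.
  by rewrite big_geq ?(ltnW Mn) // mulr_ge0 ?powR_ge0.
apply: (@le_trans _ _
  (\sum_(n <= j < M) 2 `^ (1 + a) / a * (j%:R `^ (- a) - j.+1%:R `^ (- a)))).
  rewrite !big_nat; apply: ler_sum => j /andP[nj _].
  by apply: powR_telescope => //; exact: leq_trans nj.
rewrite -mulr_sumr ler_wpM2l //.
under eq_bigr do rewrite -opprB.
rewrite sumrN telescope_sumr // opprB gerDl oppr_le0 powR_ge0 //.
Qed.

(** The first j with kj >= n is the ceiling of n / k, which appears below as [(n.-1 %/ k).+1]. *)
Lemma leq_mul_divn n k j : (0 < k)%N -> (0 < n)%N ->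
  (n <= k * j)%N = (n.-1 %/ k < j)%N.
Proof. by move=> k0 n0; rewrite ltn_divLR // mulnC prednK. Qed.

(** A row k < n starts at j of size n / k and contributes at most a multiple of n^(-a) / k, so these
    rows give the logarithm by a harmonic sum. Rows k >= n are bounded by k^(-1-a) and add only
    n^(-a). *)
Lemma hyperbolic_tail a : 0 < a -> exists2 C : R, 0 < C & forall n M M',
  (0 < n <= M)%N ->
  \sum_(1 <= k < M) \sum_(1 <= j < M' | (n <= k * j)%N) (k * j)%:R `^ (- (1 + a))
  <= C * (n%:R `^ (- a) * (1 + ln n%:R)).
Proof.
move=> a0; set C0 : R := 2 `^ (1 + a) / a.
have C00 : 0 < C0 by rewrite divr_gt0 ?powR_gt0.
exists (C0 + C0 ^+ 2); first by rewrite addr_gt0 ?exprn_gt0.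
move=> n M M' /andP[n0 nM].
have n0' : 0 < n%:R :> R by rewrite ltr0n.
have lnn : 0 <= ln n%:R :> R by rewrite ln_ge0 // ler1n.
have inner k : (0 < k)%N ->
    \sum_(1 <= j < M' | (n <= k * j)%N) (k * j)%:R `^ (- (1 + a))
    <= k%:R `^ (- (1 + a)) * (C0 * (n.-1 %/ k).+1%:R `^ (- a)).
  move=> k0; under eq_bigl do rewrite leq_mul_divn //.
  under eq_bigr do rewrite natrM powRM ?ler0n //.
  rewrite -mulr_sumr ler_wpM2l ?powR_ge0 //.
  by rewrite -(big_nat_widenl (n.-1 %/ k).+1 1 M' xpredT) //; exact: power_tail_le.
rewrite (@big_cat_nat _ _ _ n) //=.
apply: (@le_trans _ _ (C0 * n%:R `^ (- a) * \sum_(1 <= k < n) k%:R^-1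
   + C0 * \sum_(n <= k < M) k%:R `^ (- (1 + a)))).
  apply: lerD.
    rewrite mulr_sumr !big_nat; apply: ler_sum => k /andP[k0 kn].
    apply: (le_trans (inner k k0)).
    have k0' : 0 < k%:R :> R by rewrite ltr0n.
    have nk : n%:R / k%:R <= (n.-1 %/ k).+1%:R :> R.
      by rewrite ler_pdivrMr // -natrM ler_nat mulnC leq_mul_divn.
    have : (n.-1 %/ k).+1%:R `^ (- a) <= (n%:R / k%:R) `^ (- a).
      rewrite !powRN lef_pV2 ?posrE ?powR_gt0 ?divr_gt0 ?ltr0n //.
      by apply: ge0_ler_powR => //; rewrite ?nnegrE ?divr_ge0 // ltW.
    move=> h; apply: (@le_trans _ _
      (k%:R `^ (- (1 + a)) * (C0 * (n%:R / k%:R) `^ (- a)))).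
      by rewrite ler_wpM2l ?powR_ge0 // ler_wpM2l // ltW.
    rewrite le_eqVlt; apply/orP; left; apply/eqP.
    rewrite powRM ?invr_ge0 ?ltW // -powR_inv1 ?ltW // -powRrM mulN1r opprK.
    have -> : k%:R `^ (-1) = k%:R `^ (- (1 + a)) * k%:R `^ a :> R.
      by rewrite -powR_addp //; congr powR; ring.
    by ring.
  rewrite mulr_sumr !big_nat; apply: ler_sum => k /andP[nk _].
  have k0 := leq_trans n0 nk.
  apply: (le_trans (inner k k0)); rewrite mulrC ler_wpM2r ?powR_ge0 //.
  rewrite ler_piMr ?(ltW C00) // powRN invf_le1 ?powR_gt0 ?ltr0n //.
  by rewrite -[X in X <= _](powRr0 (n.-1 %/ k).+1%:R) ler_powR ?ler1n ?ltW.
have h1 := harmonic_le n0.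
have h2 := power_tail_le M a0 n0.
apply: (@le_trans _ _ (C0 * n%:R `^ (- a) * (1 + ln n%:R) + C0 * (C0 * n%:R `^ (- a)))).
  apply: lerD; first by apply: ler_wpM2l h1; rewrite mulr_ge0 ?powR_ge0 ?(ltW C00).
  by apply: ler_wpM2l h2; exact: ltW.
have := powR_ge0 (n%:R : R) (- a).
move: (n%:R `^ (- a)) lnn => w; move: (ln _) => l l0 w0.
rewrite -subr_ge0; have -> : (C0 + C0 ^+ 2) * (w * (1 + l)) -
   (C0 * w * (1 + l) + C0 * (C0 * w)) = C0 ^+ 2 * w * l by ring.
by rewrite mulr_ge0 // mulr_ge0 ?sqr_ge0.
Qed.

(** Row k holds at most n / k points and is empty for k >= n; the harmonic sum does the rest. *)
Lemma hyperbolic_count n M : (0 < n <= M)%N ->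
  \sum_(1 <= k < M) \sum_(1 <= j < M | (k * j < n)%N) 1
  <= n%:R * (1 + ln n%:R) :> R.
Proof.
move=> /andP[n0 nM].
have inner k : (0 < k)%N -> \sum_(1 <= j < M | (k * j < n)%N) 1 = (n.-1 %/ k)%:R :> R.
  move=> k0; under eq_bigl do rewrite ltnNge leq_mul_divn // -leqNgt -ltnS.
  rewrite -(big_nat_widen 1 _ M xpredT).
    by rewrite sumr_const_nat subn1.
  by rewrite -(leq_add2r 1) !addn1 ltnS (leq_trans _ nM) // -{2}(prednK n0) ltnS leq_div.
apply: (@le_trans _ _ (\sum_(1 <= k < M) (n.-1 %/ k)%:R)).
  by rewrite !big_nat; apply: ler_sum => k /andP[k0 _]; rewrite inner.
rewrite (@big_cat_nat _ _ _ n) //= [X in _ + X]big_nat [X in _ + X]big1 ?addr0; last first.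
  move=> k /andP[nk _]; rewrite divn_small // -ltnS prednK // (leq_trans _ nk).
apply: (@le_trans _ _ (n%:R * \sum_(1 <= k < n) k%:R^-1)); last first.
  by rewrite ler_wpM2l // harmonic_le.
rewrite mulr_sumr !big_nat; apply: ler_sum => k /andP[k0 _].
rewrite ler_pdivlMr ?ltr0n // -natrM ler_nat (leq_trans (leq_trunc_div _ _)) //.
exact: leq_pred.
Qed.
End HyperbolicSums.

(** * The error of the truncation method *)

Section TruncationError.
Variable R : realType.
Implicit Types (k j n m M : nat) (i : nat * nat) (x a : R).

(** * Norm constraints on finite sets of indices *)

Lemma sum_le_esum (I : choiceType) (a : I -> R) (s : seq I) : uniq s ->
  (forall t, 0 <= a t) ->
  ((\sum_(t <- s) a t)%:E <= \esum_(t in [set: I]) (a t)%:E)%E.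
Proof.
move=> us a0; apply: esum_ge; exists [set` s]%classic.
  by split => //; exact: finite_seq.
by rewrite -fsbig_seq // sumEFin.
Qed.

Lemma poweR_inv_le (X : \bar R) (s t : R) : (0 <= X)%E -> 0 < s -> 0 <= t ->
  (poweR X s^-1 <= t%:E)%E -> (X <= (t `^ s)%:E)%E.
Proof.
case: X => [x| |] //=; last by rewrite invr_eq0 => _ s0 _; rewrite gt_eqF.
rewrite !lee_fin => x0 s0 t0 h.
have := ge0_ler_powR (ltW s0) (powR_ge0 _ _) t0 h.
by rewrite -powRrM mulVf ?gt_eqF // powRr1.
Qed.

Lemma smu_sum_le (s mu : R) f (S : seq (nat * nat)) : 1 <= s -> uniq S ->
  (smu_norm s mu f <= 1)%E ->
  \sum_(i <- S) (maxn 1 (i.1 * i.2))%:R `^ (s * mu)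
     * `|fourier_legendre f i| `^ s <= 1.
Proof.
move=> s1 uS h; rewrite -lee_fin; apply: le_trans (sum_le_esum uS _) _.
  by move=> i; rewrite mulr_ge0 ?powR_ge0.
rewrite -[X in (_ <= X)%E](_ : (1 `^ s)%:E = _); last by rewrite powR1.
apply: poweR_inv_le => //; last exact: lt_le_trans s1.
by apply: esum_ge0 => i _; rewrite lee_fin mulr_ge0 ?powR_ge0.
Qed.

Lemma lp_sum_le (q delta : R) (x : nat * nat -> R) (S : seq (nat * nat)) :
  1 <= q -> 0 <= delta -> uniq S -> (lp_norm q%:E x <= delta%:E)%E ->
  \sum_(i <- S) `|x i| `^ q <= delta `^ q.
Proof.
move=> q1 d0 uS h; rewrite -lee_fin; apply: le_trans (sum_le_esum uS _) _.
  by move=> i; rewrite powR_ge0.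
apply: poweR_inv_le => //; last exact: lt_le_trans q1.
by apply: esum_ge0 => i _; rewrite lee_fin powR_ge0.
Qed.

Lemma linfty_le (delta : R) (x : nat * nat -> R) i :
  (lp_norm +oo%E x <= delta%:E)%E -> `|x i| <= delta.
Proof.
move=> h; rewrite -lee_fin; apply: le_trans h => /=.
by apply: ereal_sup_ubound; exists i.
Qed.

(* Either x <= l or l^(s-1) <= x^(s-1). *)
Lemma le_add_powR (x l s : R) : 0 <= x -> 0 < l -> 1 <= s ->
  x <= l + x `^ s * l `^ (1 - s).
Proof.
move=> x0 l0 s1; have [xl|lx] := leP x l.
  by rewrite (le_trans xl) // lerDl mulr_ge0 ?powR_ge0.
have {}x0 := lt_trans l0 lx.
rewrite -[X in X <= _]add0r lerD ?(ltW l0) //.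
rewrite -{1}(powRr1 (ltW x0)) -{1}(subrKC s 1) powR_addp // ler_wpM2l ?powR_ge0 //.
have -> : 1 - s = - (s - 1) by ring.
rewrite !powRN lef_pV2 ?posrE ?powR_gt0 //.
by apply: ge0_ler_powR; rewrite ?nnegrE ?subr_ge0 // ltW.
Qed.

Implicit Types (S : seq (nat * nat)) (c e : nat * nat -> R).
Local Notation wt i := ((i.1 * i.2)%:R : R).

(** With m = kj, [le_add_powR] is applied to x = m^mu |c| and l = m^(-1/s). The first term becomes
    m^(-1-a), the second the summand of the constraint times m^(-a) <= n^(-a). *)
Lemma weighted_tail (s mu g a : R) S c n : 1 <= s -> 0 <= a -> (0 < n)%N ->
  a = mu - g + 1 / s - 1 ->
  (forall i, i \in S -> (n <= i.1 * i.2)%N) ->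
  \sum_(i <- S) wt i `^ (s * mu) * `|c i| `^ s <= 1 ->
  \sum_(i <- S) `|c i| * wt i `^ g
  <= \sum_(i <- S) wt i `^ (- (1 + a)) + n%:R `^ (- a).
Proof.
move=> s1 a0 n0 aE nS cS.
have s0 : 0 < s by exact: lt_le_trans s1.
apply: le_trans (_ : \sum_(i <- S) (wt i `^ (- (1 + a))
    + wt i `^ (s * mu) * `|c i| `^ s * n%:R `^ (- a)) <= _); last first.
  by rewrite big_split /= lerD2l -mulr_suml ler_piMl ?powR_ge0.
rewrite !big_seq; apply: ler_sum => i iS.
have ni := nS i iS; have m0 : 0 < wt i by rewrite ltr0n (leq_trans n0).
set m := wt i in m0 *.
have := le_add_powR (x := m `^ mu * `|c i|) _ (powR_gt0 (- s^-1) m0) s1.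
rewrite mulr_ge0 ?powR_ge0 // => /(_ isT) h.
have {h} := ler_wpM2r (powR_ge0 m (g - mu)) h.
rewrite mulrAC -powR_addp // subrKC mulrDl -powR_addp //.
rewrite powRM ?powR_ge0 // -!powRrM.
have -> : - s^-1 + (g - mu) = - (1 + a) by rewrite aE; ring.
rewrite mulrC => h; apply: (le_trans h); rewrite lerD2l.
rewrite [mu * s]mulrC -[X in X <= _]mulrA ler_wpM2l ?mulr_ge0 ?powR_ge0 //.
rewrite -powR_addp //.
have -> : - s^-1 * (1 - s) + (g - mu) = - a by rewrite aE; field; rewrite gt_eqF.
rewrite !powRN lef_pV2 ?posrE ?powR_gt0 ?ltr0n //.
by apply: ge0_ler_powR; rewrite ?nnegrE ?ler0n ?ler_nat.
exact: leq_trans ni.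
Qed.

(** Here x = |e| / delta and l = m^(-1/q) with m = kj. The first term is at most n^(g-1/q) at each
    point and is multiplied by the number of points; the second sums to at most n^(g+1-1/q) by the
    constraint. *)
Lemma weighted_noise (q delta g : R) S e n : 1 <= q -> 0 < delta -> (0 < n)%N ->
  1 <= g ->
  (forall i, i \in S -> (0 < i.1 * i.2 < n)%N) ->
  \sum_(i <- S) `|e i| `^ q <= delta `^ q ->
  (size S)%:R <= n%:R * (1 + ln n%:R) :> R ->
  \sum_(i <- S) `|e i| * wt i `^ g
  <= delta * (n%:R `^ (g + 1 - q^-1) * (2 + ln n%:R)).
Proof.
move=> q1 d0 n0 g1 nS eS cS.
have q0 : 0 < q by exact: lt_le_trans q1.
have qV : q^-1 <= 1 by rewrite invf_le1.
have n0' : 0 < n%:R :> R by rewrite ltr0n.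
apply: le_trans (_ : \sum_(i <- S) (delta * n%:R `^ (g - q^-1)
    + delta * (delta `^ (- q) * `|e i| `^ q * n%:R `^ (g + 1 - q^-1))) <= _); last first.
  rewrite big_split /= big_const_seq count_predT iter_addr addr0 -[_ *+ size S]mulr_natr.
  rewrite -!mulr_sumr -mulr_suml -mulr_sumr -mulrA -mulrDr ler_wpM2l ?(ltW d0) //.
  have -> : n%:R `^ (g + 1 - q^-1) = n%:R `^ (g - q^-1) * n%:R :> R.
    by rewrite -[X in _ * X](powRr1 (ltW n0')) -powR_addp //; congr powR; ring.
  have -> : n%:R `^ (g - q^-1) * n%:R * (2 + ln n%:R) =
    n%:R `^ (g - q^-1) * (n%:R * (1 + ln n%:R)) + 1 * (n%:R `^ (g - q^-1) * n%:R) by ring.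
  rewrite lerD // ?ler_wpM2l ?powR_ge0 //.
  rewrite ler_wpM2r ?mulr_ge0 ?powR_ge0 // powRN mulrC ler_pdivrMr ?powR_gt0 //.
  by rewrite mul1r.
rewrite !big_seq; apply: ler_sum => i iS.
have /andP[m0' ni] := nS i iS; have m0 : 0 < wt i by rewrite ltr0n.
have mn : wt i <= n%:R by rewrite ler_nat ltnW.
set m := wt i in m0 mn *.
have := le_add_powR (x := `|e i| / delta) _ (powR_gt0 (- q^-1) m0) q1.
rewrite divr_ge0 ?(ltW d0) // => /(_ isT) h.
have {h} := ler_wpM2r (powR_ge0 m g) h.
rewrite -(ler_pM2l d0) => h.
have -> : `|e i| * m `^ g = delta * (`|e i| / delta * m `^ g).
  by field; rewrite gt_eqF.
apply: (le_trans h); rewrite -mulrDr ler_wpM2l ?(ltW d0) // mulrDl.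
rewrite -powR_addp // [_ + g]addrC lerD //.
  by rewrite powR_le ?(ltW m0) // subr_ge0 (le_trans qV).
rewrite -powRrM powRM ?invr_ge0 ?(ltW d0) // -(powR_inv1 (ltW d0)) -powRrM mulN1r.
rewrite -[X in X <= _]mulrA -powR_addp // [X in X * _]mulrC ler_wpM2l //.
  by rewrite mulr_ge0 ?powR_ge0.
have -> : - q^-1 * (1 - q) + g = g + 1 - q^-1 by field; rewrite gt_eqF.
by rewrite powR_le ?(ltW m0) //; move: qV g1; lra.
Qed.

(** * Hyperbolic crosses inside rectangles; bias and noise *)

Definition rectangle r M M' : seq (nat * nat) :=
  [seq (k, j) | k <- index_iota r M, j <- index_iota r M'].

Lemma mem_rectangle r M M' i :
  (i \in rectangle r M M') = (r <= i.1 < M)%N && (r <= i.2 < M')%N.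
Proof.
case: i => k j; rewrite -!mem_index_iota.
apply/allpairsP/andP => [[[k' j'] [/= ? ? [-> ->]]] //|[kM jM]].
by exists (k, j).
Qed.

Lemma uniq_rectangle r M M' : uniq (rectangle r M M').
Proof.
by apply: allpairs_uniq; rewrite ?iota_uniq // => -[a b] [a' b'] _ _ [-> ->].
Qed.

Lemma sum_nat_widenl_le r M (P : pred nat) (F : nat -> R) : (0 < r)%N ->
  (forall k, 0 <= F k) ->
  \sum_(r <= k < M | P k) F k <= \sum_(1 <= k < M | P k) F k.
Proof.
move=> r0 F0; rewrite (big_nat_widenl r 1) // [X in X <= _]big_mkcondr.
by apply: ler_sum => k _; case: ifP.
Qed.

Lemma sum_rectangle_le r M M' (P : pred (nat * nat)) (F : nat * nat -> R) :
  (0 < r)%N -> (forall i, 0 <= F i) ->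
  \sum_(i <- rectangle r M M' | P i) F i
  <= \sum_(1 <= k < M) \sum_(1 <= j < M' | P (k, j)) F (k, j).
Proof.
move=> r0 F0; rewrite big_mkcond big_allpairs.
apply: le_trans (_ : \sum_(r <= k < M) \sum_(1 <= j < M' | P (k, j)) F (k, j) <= _).
  by apply: ler_sum => k _; rewrite -big_mkcond; exact: sum_nat_widenl_le.
by apply: sum_nat_widenl_le => // k; exact: sumr_ge0.
Qed.

Lemma mem_hyp_cross r n i : (0 < r)%N -> (i \in hyp_cross r n) =
  [&& (r <= i.1)%N, (r <= i.2)%N & (i.1 * i.2 < r * n)%N].
Proof.
move=> r0; have -> : (i \in hyp_cross r n) =
    (i \in rectangle r (r + r * n) (r + r * n)) && (i.1 * i.2 < r * n)%N.
  by rewrite !inE /= /rectangle /index_iota addKn.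
rewrite mem_rectangle; apply/idP/idP => [/andP[/andP[/andP[-> _] /andP[-> _]] ->] //|].
move=> /and3P[ri1 ri2 h]; rewrite ri1 ri2 h !andbT /=.
have i10 := leq_trans r0 ri1; have i20 := leq_trans r0 ri2.
apply/andP; split; rewrite (leq_trans _ (leq_addl _ _)) // (leq_ltn_trans _ h) //.
  exact: leq_pmulr.
exact: leq_pmull.
Qed.

(** Both coordinates of a point of the cross are below rn, as each is at least 1 and their product
    is below rn. *)
Lemma hyp_cross_rectangle r n M M' : (0 < r)%N -> (r * n <= M)%N -> (r * n <= M')%N ->
  perm_eq (hyp_cross r n) [seq i <- rectangle r M M' | (i.1 * i.2 < r * n)%N].
Proof.
move=> r0 nM nM'; apply: uniq_perm; rewrite ?fset_uniq ?filter_uniq ?uniq_rectangle //.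
move=> i; rewrite mem_hyp_cross // mem_filter mem_rectangle.
apply/idP/idP => [/and3P[ri1 ri2 h]|/and3P[h /andP[-> _] /andP[-> _]] //].
have i10 := leq_trans r0 ri1; have i20 := leq_trans r0 ri2.
rewrite ri1 ri2 h /=.
rewrite (leq_trans (leq_ltn_trans _ h) nM) ?leq_pmulr //.
by rewrite (leq_trans (leq_ltn_trans _ h) nM') ?leq_pmull.
Qed.

Lemma card_hyp_cross_le r n : (0 < r)%N -> (0 < n)%N ->
  #|` hyp_cross r n|%:R <= (r * n)%:R * (1 + ln (r * n)%:R) :> R.
Proof.
move=> r0 n0; have rn0 : (0 < r * n)%N by rewrite muln_gt0 r0.
rewrite (perm_size (hyp_cross_rectangle r0 (leqnn _) (leqnn _))).
rewrite -sum1_size natr_sum big_filter.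
apply: le_trans (sum_rectangle_le _ _ _ r0 _) _ => //.
by apply: hyperbolic_count; rewrite rn0 leqnn.
Qed.

Lemma truncationE r n (x : nat * nat -> R) z :
  @truncation R r n (galerkin_info (hyp_cross r n) x) z
  = \sum_(i <- hyp_cross r n) x i * deriv_basis r i z.
Proof.
rewrite /truncation big_seq_fsetE.
by apply: eq_bigr => w _; rewrite ffunE.
Qed.

Lemma deriv_basis_bound r i (z : R * R) : (1 <= r)%N -> (r <= i.1)%N -> (r <= i.2)%N ->
  @squareQ R z -> `|deriv_basis r i z| <= 4 * wt i `^ ((2 * r)%:R + 1 / 2).
Proof.
move=> r1 ri1 ri2 /andP[z1 z2]; rewrite normrM.
have [c _ H] := legendre_at1_bounds R r.
have b k t : (r <= k)%N -> -1 <= t <= 1 ->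
    `|(legendre R k)^`(r).[t]| <= 2 * k%:R `^ ((2 * r)%:R + 1 / 2).
  move=> rk t1; apply: le_trans (legendre_max rk t1) _.
  by have /andP[] := H k (introT andP (conj r1 rk)).
apply: le_trans (ler_pM _ _ (b _ _ ri1 z1) (b _ _ ri2 z2)) _ => //.
rewrite [(i.1 * i.2)%:R]natrM (powRM _ (ler0n _ _) (ler0n _ _)).
by rewrite le_eqVlt; apply/orP; left; apply/eqP; ring.
Qed.

(** The bound is uniform in the rectangle, so it serves both the convergence of the partial sums and
    the bias of the truncation. *)
Lemma hyperbolic_tail_partial r (s mu : R) : (1 <= r)%N -> 1 <= s ->
  let g := (2 * r)%:R + 1 / 2 in let a := mu - g + 1 / s - 1 in 0 < a ->
  exists2 C : R, 0 < C & forall f n M M' z, (0 < n)%N ->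
  (r * n <= M)%N -> (r * n <= M')%N ->
  (smu_norm s mu f <= 1)%E -> @squareQ R z ->
  `|\sum_(i <- rectangle r M M') fourier_legendre f i * deriv_basis r i z
    - \sum_(i <- hyp_cross r n) fourier_legendre f i * deriv_basis r i z|
  <= C * ((r * n)%:R `^ (- a) * (1 + ln (r * n)%:R)).
Proof.
move=> r1 s1 g a a0; have [C C0 HC] := hyperbolic_tail a0.
exists (4 * (C + 1)); first by rewrite mulr_gt0 // addr_gt0.
move=> f n M M' z n0 nM nM' fs zQ.
have rn0 : (0 < r * n)%N by rewrite muln_gt0 r1.
rewrite (perm_big _ (hyp_cross_rectangle r1 nM nM')) big_filter.
rewrite (bigID (fun i => (i.1 * i.2 < r * n)%N)) /= [X in X - _]addrC addrK.
under eq_bigl do rewrite -leqNgt.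
rewrite -big_filter; set S := [seq i <- _ | _].
have uS : uniq S by rewrite filter_uniq // uniq_rectangle.
have SP i : i \in S -> [&& (r <= i.1)%N, (r <= i.2)%N & (r * n <= i.1 * i.2)%N].
  by rewrite mem_filter mem_rectangle => /and3P[-> /andP[-> _] /andP[-> _]].
apply: le_trans (ler_norm_sum _ _ _) _.
apply: le_trans (_ : \sum_(i <- S) 4 * (`|fourier_legendre f i| * wt i `^ g) <= _).
  rewrite !big_seq; apply: ler_sum => i /SP/and3P[h1 h2 _].
  by rewrite normrM mulrCA ler_wpM2l // deriv_basis_bound.
rewrite -mulr_sumr -mulrA ler_wpM2l // mulrDl mul1r.
have cS := smu_sum_le s1 uS fs.
have nS i : i \in S -> (r * n <= i.1 * i.2)%N by case/SP/and3P.
(* Off the cross kj >= rn >= 1, so the weight of the class is a plain power of kj. *)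
have mS i : i \in S -> maxn 1 (i.1 * i.2) = (i.1 * i.2)%N.
  by move=> iS; apply/maxn_idPr; exact: leq_trans (nS i iS).
have cS' : \sum_(i <- S) wt i `^ (s * mu) * `|fourier_legendre f i| `^ s <= 1.
  by apply: le_trans cS; rewrite !big_seq; apply: ler_sum => i iS; rewrite mS.
apply: le_trans (weighted_tail (a := a) s1 (ltW a0) rn0 _ nS cS') _ => //.
apply: lerD; last first.
  by rewrite ler_peMr ?powR_ge0 // lerDl ln_ge0 // ler1n.
rewrite big_filter; apply: le_trans (sum_rectangle_le _ _ _ r1 _) _.
  by move=> i; exact: powR_ge0.
by apply: HC; rewrite rn0.
Qed.

Lemma noise_bound r (p : \bar R) : (1 <= r)%N -> (1 <= p)%E ->
  let g := (2 * r)%:R + 1 / 2 in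
  forall f (x : nat * nat -> R) n delta z, (0 < n)%N -> 0 < delta ->
  @admissible R p delta f x -> @squareQ R z ->
  `|\sum_(i <- hyp_cross r n) fourier_legendre f i * deriv_basis r i z
    - \sum_(i <- hyp_cross r n) x i * deriv_basis r i z|
  <= 8 * (delta * ((r * n)%:R `^ (g + 1 - fine (p^-1)%E) * (1 + ln (r * n)%:R))).
Proof.
move=> r1 p1 g f x n delta z n0 d0 fx zQ.
have rn0 : (0 < r * n)%N by rewrite muln_gt0 r1.
have ln0 : 0 <= ln (r * n)%:R :> R by rewrite ln_ge0 // ler1n.
rewrite -sumrB; apply: le_trans (ler_norm_sum _ _ _) _.
pose e i := fourier_legendre f i - x i.
apply: le_trans (_ : \sum_(i <- hyp_cross r n) 4 * (`|e i| * wt i `^ g) <= _).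
  rewrite !big_seq; apply: ler_sum => i; rewrite mem_hyp_cross // => /and3P[h1 h2 _].
  by rewrite -mulrBl normrM mulrCA ler_wpM2l // deriv_basis_bound.
(* The 4 comes from [deriv_basis_bound]; the 2 absorbs 2 + ln <= 2(1 + ln). *)
rewrite -mulr_sumr; have -> : 8 = 4 * 2 :> R by rewrite -natrM.
rewrite -mulrA ler_wpM2l //.
have g1 : 1 <= g.
  rewrite -[X in X <= _]addr0 lerD // ler1n muln_gt0; exact: r1.
have nS i : i \in hyp_cross r n -> (0 < i.1 * i.2 < r * n)%N.
  rewrite mem_hyp_cross // => /and3P[h1 h2 ->]; rewrite andbT muln_gt0.
  by rewrite (leq_trans r1 h1) (leq_trans r1).
have cS := card_hyp_cross_le r1 n0.
have uS : uniq (hyp_cross r n) by exact: fset_uniq.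
case: p p1 fx => [q| |] p1 fx //.
  have q1 : 1 <= q by [].
  have -> : fine (q%:E^-1)%E = q^-1.
    by rewrite inver gt_eqF // (lt_le_trans _ q1).
  apply: le_trans (weighted_noise q1 d0 rn0 g1 nS (lp_sum_le q1 (ltW d0) uS fx) cS) _.
  rewrite [X in _ <= X]mulrCA ler_wpM2l ?(ltW d0) //.
  rewrite [X in _ <= X]mulrCA ler_wpM2l ?powR_ge0 //.
  by move: ln0; move: (ln _) => l l0; lra.
(* For p = +oo the value of 1/p is 0, every coefficient is off by at most delta, and the number of
   points supplies the remaining power and the logarithm. *)
rewrite invey /= subr0.
apply: le_trans (_ : \sum_(i <- hyp_cross r n) delta * (r * n)%:R `^ g <= _).
  rewrite !big_seq; apply: ler_sum => i /nS/andP[_ h].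
  rewrite ler_pM ?powR_ge0 ?(linfty_le i fx) //.
  by rewrite powR_le ?(le_trans _ g1) // ler_nat ltnW.
rewrite big_const_seq count_predT iter_addr addr0 -[_ *+ _]mulr_natr.
rewrite [_ `^ (g + 1)]powR_addp ?ltr0n // powRr1 ?ler0n //.
rewrite -mulrA [X in _ <= X]mulrCA ler_wpM2l ?(ltW d0) //.
rewrite [X in _ <= X]mulrCA -[X in _ <= X]mulrA ler_wpM2l ?powR_ge0 //.
apply: (le_trans cS); rewrite mulrCA ler_peMl ?mulr_ge0 ?addr_ge0 //.
by rewrite ler1n.
Qed.

(** Half of the decay pays for the logarithm: ln m <= (2/a) m^(a/2). The threshold y solves D
    y^(-a/2) = eps. *)
Lemma power_log_small (a C : R) : 0 < a -> 0 < C -> forall eps : R, 0 < eps ->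
  exists2 n, (0 < n)%N & forall m, (n <= m)%N ->
    C * (m%:R `^ (- a) * (1 + ln m%:R)) < eps.
Proof.
move=> a0 C0 eps e0; pose D := C * (1 + 2 / a).
have D0 : 0 < D by rewrite mulr_gt0 // addr_gt0 // divr_gt0.
pose y := (D / eps) `^ (2 / a).
exists (Num.truncn y).+1 => // m nm.
have m0 : (0 < m)%N by exact: leq_ltn_trans nm.
have m0' : 0 < m%:R :> R by rewrite ltr0n.
have ym : y < m%:R.
  by apply: lt_le_trans (truncnS_gt _) _; rewrite ler_nat.
have l1 : ln m%:R <= 2 / a * m%:R `^ (a / 2).
  have := ln_sublinear (powR_gt0 (a / 2) m0').
  rewrite ln_powR => /ltW h.
  rewrite -(ler_pM2l (_ : 0 < a / 2)) ?divr_gt0 // mulrA.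
  by have -> : a / 2 * (2 / a) = 1 by [field; rewrite gt_eqF]; rewrite mul1r.
have h1 : 1 <= m%:R `^ (a / 2).
  by rewrite -[X in X <= _](powRr0 m%:R) ler_powR ?ler1n // divr_ge0 ?ltW.
have : C * (m%:R `^ (- a) * (1 + ln m%:R)) <= D * m%:R `^ (- (a / 2)).
  rewrite /D -mulrA ler_pM2l //.
  have -> : m%:R `^ (- (a / 2)) = m%:R `^ (- a) * m%:R `^ (a / 2).
    by rewrite -powR_addp //; congr powR; field.
  by rewrite mulrCA ler_wpM2l ?powR_ge0 //; move: h1 l1; lra.
move=> h; apply: le_lt_trans h _.
rewrite powRN ltr_pdivrMr ?powR_gt0 // mulrC -ltr_pdivrMr //.
have -> : D / eps = y `^ (a / 2).
  rewrite /y -powRrM; have -> : 2 / a * (a / 2) = 1 by field; rewrite gt_eqF.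
  by rewrite powRr1 // ltW // divr_gt0.
by apply: gt0_ltr_powR; rewrite ?nnegrE ?powR_ge0 ?divr_gt0 // ltW.
Qed.

(** * Convergence of the mixed derivative and total error of the truncation *)

Section Recovery.
Variables (r : nat) (s mu : R).
Hypotheses (r1 : (1 <= r)%N) (s1 : 1 <= s).
Let g := (2 * r)%:R + 1 / 2 : R.
Let a := mu - g + 1 / s - 1.
Hypothesis a0 : 0 < a.

Definition partial_deriv (f : R * R -> R) z (mn : nat * nat) : R :=
  \sum_(r <= k < mn.1) \sum_(r <= j < mn.2)
    fourier_legendre f (k, j) * deriv_basis r (k, j) z.

Lemma partial_derivE f z mn : partial_deriv f z mn =
  \sum_(i <- rectangle r mn.1 mn.2) fourier_legendre f i * deriv_basis r i z.
Proof. by rewrite /partial_deriv /rectangle big_allpairs. Qed.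

Lemma near_ge_pair n : \forall mn \near filter_prod \oo \oo,
  (n <= mn.1)%N /\ (n <= mn.2)%N.
Proof.
exists ([set k | (n <= k)%N], [set k | (n <= k)%N])%classic => //.
by split; exact: nbhs_infty_ge.
Qed.

(** All large rectangular sums are within eps of the sum over one large cross, so they form a Cauchy
    family. This makes the [lim] in [mixed_deriv] a genuine limit and not a default value. *)
Lemma partial_deriv_cvg f z : (smu_norm s mu f <= 1)%E -> @squareQ R z ->
  cvg (partial_deriv f z @ filter_prod \oo \oo).
Proof.
move=> fs zQ; have [C C0 HC] := hyperbolic_tail_partial r1 s1 a0.
apply/cauchy_cvgP/cauchy_exP => eps e0.
have [n n0 Hn] := power_log_small a0 C0 e0.
exists (\sum_(i <- hyp_cross r n) fourier_legendre f i * deriv_basis r i z).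
apply: filterS (near_ge_pair (r * n)) => mn [h1 h2] /=.
rewrite /ball /= distrC partial_derivE.
apply: le_lt_trans (HC f n mn.1 mn.2 z n0 h1 h2 fs zQ) _.
by apply: Hn; rewrite leq_pmull.
Qed.

Lemma truncation_error (p : \bar R) : (1 <= p)%E ->
  exists2 C : R, 0 < C & forall n delta, (0 < n)%N -> 0 < delta ->
  (recovery_error r s mu p delta (@truncation R r n)
   <= (C * ((r * n)%:R `^ (- a) + delta * (r * n)%:R `^ (g + 1 - fine (p^-1)%E))
       * (1 + ln (r * n)%:R))%:E)%E.
Proof.
move=> p1; have [C C0 HC] := hyperbolic_tail_partial r1 s1 a0.
exists (C + 8); first by rewrite addr_gt0.
move=> n delta n0 d0; apply: ge_ereal_sup => _ [f [_ fs] <-].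
apply: ge_ereal_sup => _ [x fx <-]; apply: ge_ereal_sup => _ [z zQ <-].
rewrite lee_fin truncationE /mixed_deriv -/(partial_deriv f z).
set T := \sum_(i <- _) _; set E := _ * _.
have cv := partial_deriv_cvg fs zQ.
(* The bound holds for every large rectangular sum and is a closed condition, so it passes to the
   limit. *)
apply: (@closed_cvg _ _ (filter_prod \oo \oo) _
  (fun mn => `|partial_deriv f z mn - T|) [set y | y <= E]%classic).
- exact: closed_le.
- apply: filterS (near_ge_pair (r * n)) => mn [h1 h2] /=.
  have t1 := HC f n mn.1 mn.2 z n0 h1 h2 fs zQ.
  have t2 := noise_bound r1 p1 n0 d0 fx zQ.
  rewrite partial_derivE.
  (* The cross sum with exact coefficients separates bias from noise. *)
  apply: le_trans (ler_distD (\sum_(i <- hyp_cross r n)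
    fourier_legendre f i * deriv_basis r i z) _ _) _.
  apply: (le_trans (lerD t1 t2)).
  rewrite -/g -/a /E.
  have : 0 <= 1 + ln (r * n)%:R :> R.
    by rewrite addr_ge0 // ln_ge0 // ler1n muln_gt0 r1.
  have := powR_ge0 (r * n)%:R (- a).
  have := powR_ge0 (r * n)%:R (g + 1 - fine (p^-1)%E).
  move: (1 + _) (_ `^ _) (_ `^ _) => l x1 x2 x10 x20 l0.
  rewrite -subr_ge0 (_ : _ - _ = C * (delta * x2 * l) + 8 * (x1 * l)); last by ring.
  by rewrite addr_ge0 // !mulr_ge0 ?(ltW C0) ?(ltW d0).
- by apply: cvg_norm; apply: cvgB => //; exact: cvg_cst.
Qed.
End Recovery.
End TruncationError.

(** * The lower bound *)

Section LowerBound.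
Variable R : realType.
Implicit Types (k j n N : nat) (i : nat * nat) (K : seq nat).

Lemma lp_norm0 (p : \bar R) (delta : R) : (1 <= p)%E -> 0 < delta ->
  (lp_norm p (fun=> 0%R) <= delta%:E)%E.
Proof.
case: p => [q| |] //= q1 d0; last first.
  by apply: ge_ereal_sup => _ [i _ <-]; rewrite normr0 lee_fin ltW.
rewrite lee_fin in q1; have q0 := lt_le_trans ltr01 q1.
rewrite esum1; first by rewrite poweR_EFin powR0 ?invr_eq0 ?gt_eqF // lee_fin ltW.
by move=> i _; rewrite normr0 powR0 // gt_eqF.
Qed.

(** Division by the square integral makes the pairing with [legendre] a Kronecker delta. *)
Definition dual_legendre k : {poly R} :=
  (integ (legendre R k * legendre R k))^-1 *: legendre R k.

Lemma integ_dual_legendre k j :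
  integ (dual_legendre k * legendre R j) = (k == j)%:R.
Proof.
rewrite /dual_legendre -scalerAl integZ; case: eqVneq => [<-|kj].
  by rewrite mulVf // gt_eqF // legendre_sq_gt0.
by rewrite [X in _ * X]legendre_orthogonal ?mulr0.
Qed.

(** The function whose coefficients are c at the points (k, r) with k in K and zero elsewhere; see
    [fourier_strip]. *)
Definition strip_fun r K (c : R) (z : R * R) : R :=
  (\sum_(k <- K) dual_legendre k).[z.1] * (c *: dual_legendre r).[z.2].

Lemma fourier_strip r K c i : uniq K ->
  fourier_legendre (strip_fun r K c) i = c * ((i.1 \in K) && (i.2 == r))%:R.
Proof.
move=> uK; rewrite fourier_legendre_prod -scalerAl integZ integ_dual_legendre.
rewrite mulr_suml integ_sum (eq_bigr (fun k => if k == i.1 then 1 else 0)); last first.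
  by move=> k _; rewrite integ_dual_legendre; case: eqP.
rewrite -big_mkcond -(natr_sum _ _ _ (fun=> 1%N)) sum1_count count_uniq_mem //.
by rewrite [r == _]eq_sym mulrCA -natrM mulnb.
Qed.

(** The sum in the norm reduces to the strip, where each term is at most (B^mu |c|)^s. *)
Lemma smu_norm_strip r K c (s mu B : R) : 1 <= s -> 0 <= mu -> uniq K ->
  (forall k, k \in K -> (maxn 1 (k * r))%:R <= B) ->
  (size K)%:R * (B `^ mu * `|c|) `^ s <= 1 ->
  (smu_norm s mu (strip_fun r K c) <= 1)%E.
Proof.
move=> s1 mu0 uK KB h; have s0 := lt_le_trans ltr01 s1.
pose S := [seq (k, r) | k <- K].
have uS : uniq S by rewrite map_inj_uniq // => x y [].
have SE i : (i \in S) = (i.1 \in K) && (i.2 == r).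
  case: i => k j; apply/mapP/andP => /= [[k' kK [-> ->]] //|[kK /eqP ->]].
  by exists k.
rewrite /smu_norm; set F := fun i => _.
have -> : (\esum_(i in [set: nat * nat]) F i = \sum_(i <- S) F i)%E.
  rewrite (_ : (\sum_(i <- S) F i)%E = (\sum_(i \in [set` S]) F i)%E); last first.
    by rewrite fsbig_seq.
  rewrite -esum_fset; last 2 first.
  - exact: finite_seq.
  - by move=> i _; rewrite lee_fin mulr_ge0 ?powR_ge0.
  rewrite [RHS]esum_mkcond; apply: eq_esum => i _; case: ifPn => // iS.
  rewrite /F fourier_strip // (_ : _ && _ = false) ?mulr0 ?normr0.
    by rewrite powR0 ?mulr0 // gt_eqF.
  by apply/negbTE; rewrite -SE; apply: contra iS; rewrite inE.
rewrite sumEFin poweR_EFin lee_fin -[X in _ <= X](_ : 1 `^ s^-1 = _);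
  last by rewrite powR1.
apply: powR_le; rewrite ?invr_ge0 ?(ltW s0) //.
  by apply: sumr_ge0 => i _; rewrite mulr_ge0 ?powR_ge0.
apply: le_trans h; rewrite big_map [_ * (_ `^ s)]mulrC mulr_natr.
apply: le_trans (_ : \sum_(k <- K) (B `^ mu * `|c|) `^ s <= _); last first.
  by rewrite big_const_seq count_predT iter_addr addr0.
rewrite !big_seq; apply: ler_sum => k kK /=.
rewrite fourier_strip //= kK eqxx mulr1 powRM ?powR_ge0 // -powRrM mulrC.
rewrite [mu * s]mulrC [X in X <= _]mulrC ler_wpM2r ?powR_ge0 //.
by rewrite powR_le ?mulr_ge0 ?KB ?(ltW s0).
Qed.

Lemma strip_in_ball r K c (s mu : R) : (smu_norm s mu (strip_fun r K c) <= 1)%E ->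
  @Lsmu_ball R s mu (strip_fun r K c).
Proof. by move=> h; split => //; exact: prod_Lfun2. Qed.

(** The rectangular partial sums are constant as soon as the rectangle contains the strip. *)
Lemma mixed_deriv_strip r K c z : uniq K -> (forall k, k \in K -> (r <= k)%N) ->
  mixed_deriv r (strip_fun r K c) z
  = c * \sum_(k <- K) deriv_basis r (k, r) z.
Proof.
move=> uK Kr; apply: cvg_lim => //; apply: cvg_near_cst.
set n := maxn r.+1 (\max_(k <- K) k).+1.
have Kn k : k \in K -> (k < n)%N.
  move=> kK; rewrite leq_max ltnS; apply/orP; right.
  exact: (@leq_bigmax_seq _ K xpredT (fun k => k)).
apply: filterS (near_ge_pair n) => -[M M'] /= [nM nM'].
transitivity (partial_deriv r (strip_fun r K c) z (M, M')); first by [].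
rewrite partial_derivE /= mulr_sumr.
pose S := [seq (k, r) | k <- K].
have uS : uniq S by rewrite map_inj_uniq // => x y [].
have SE i : (i \in S) = (i.1 \in K) && (i.2 == r).
  case: i => k j; apply/mapP/andP => /= [[k' kK [-> ->]] //|[kK /eqP ->]].
  by exists k.
rewrite (bigID (mem S)) /= [X in _ + X]big1 ?addr0; last first.
  by move=> i; rewrite /= SE fourier_strip // => /negbTE ->; rewrite mulr0 mul0r.
rewrite -big_filter (perm_big S); last first.
  apply: uniq_perm; rewrite ?filter_uniq ?uniq_rectangle // => i.
  rewrite mem_filter mem_rectangle SE; apply/andP/idP => [[]//|].
  move=> /andP[iK /eqP iE]; split; first by rewrite iK iE eqxx.
  rewrite iE leqnn Kr // (leq_trans (Kn _ iK)) //=.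
  by apply: leq_trans nM'; rewrite leq_max ltnSn.
rewrite big_map !big_seq; apply: eq_bigr => k kK.
by rewrite fourier_strip //= kK eqxx mulr1.
Qed.

(* Both signs of c give the same data, so one of the two functions is missed by
   at least the size of its derivative at the corner of Q. *)
Lemma recovery_error_strip r K c (s mu delta : R) (p : \bar R)
  (Omega : {fset nat * nat}) psi :
  (1 <= p)%E -> 0 < delta -> uniq K -> (forall k, k \in K -> (r <= k)%N) ->
  (forall k, k \in K -> (k, r) \notin Omega) -> 
  (smu_norm s mu (strip_fun r K c) <= 1)%E ->
  (smu_norm s mu (strip_fun r K (- c)) <= 1)%E ->
  ((c * \sum_(k <- K) deriv_basis r (k, r) (1, 1))%:E
    <= @recovery_error R r s mu p delta Omega psi)%E.
Proof.
move=> p1 d0 uK Kr KO h h'; set V := c * _.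
pose y : {ffun Omega -> R} := [ffun=> 0].
have lower b : (smu_norm s mu (strip_fun r K b) <= 1)%E ->
    (`|b * \sum_(k <- K) deriv_basis r (k, r) (1, 1) - psi y (1, 1)|%:E
     <= @recovery_error R r s mu p delta Omega psi)%E.
  move=> hb; pose f := strip_fun r K b.
  (* The exact coefficients are admissible data, and they vanish on Omega because the strip avoids
     it. *)
  have yE : galerkin_info Omega (fourier_legendre f) = y.
    apply/ffunP => w; rewrite !ffunE fourier_strip //.
    case: andP; rewrite ?mulr0 // => -[wK /eqP wr].
    by have := KO _ wK; rewrite -wr -surjective_pairing fsvalP.
  apply: (@le_trans _ _ (ereal_sup [set supnormQ (fun z => mixed_deriv r f z
      - psi (galerkin_info Omega x) z) | x in admissible p delta f]%classic)); last first.
    by apply: ereal_sup_ubound; exists f => //; exact: strip_in_ball.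
  apply: (@le_trans _ _ (supnormQ (fun z => mixed_deriv r f z
      - psi (galerkin_info Omega (fourier_legendre f)) z))); last first.
    apply: ereal_sup_ubound; exists (fourier_legendre f) => //.
    rewrite /admissible /=.
    have -> : (fun i => fourier_legendre f i - fourier_legendre f i) = (fun=> 0%R).
      by apply/funext => i; rewrite subrr.
    exact: lp_norm0.
  apply: ereal_sup_ubound; exists (1, 1).
    by rewrite /squareQ /= lexx; lra.
  by rewrite mixed_deriv_strip // yE.
have := lower _ h; have := lower _ h'; rewrite mulNr -/V.
set E := recovery_error _ _ _ _ _; set u := psi _ _ => l1 l2.
(* The map answers u at the corner for both functions: if u <= 0 then V - u >= V, otherwise u - (-V)
   >= V. *)
have [Vu|Vu] := leP u 0.
  apply: le_trans l2; rewrite lee_fin; apply: le_trans (ler_norm _); lra.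
apply: le_trans l1; rewrite lee_fin distrC; apply: le_trans (ler_norm _); lra.
Qed.
Lemma min_radius_lower r (s mu : R) (p : \bar R) : (1 <= r)%N -> 1 <= s -> 0 <= mu ->
  (1 <= p)%E -> exists2 A : R, 0 < A & forall delta N, 0 < delta -> (0 < N)%N ->
  ((A * N%:R `^ (- (mu - ((2 * r)%:R + 1 / 2) + 1 / s - 1)))%:E
    <= min_radius r s mu p delta N)%E.
Proof.
move=> r1 s1 mu0 p1; have s0 := lt_le_trans ltr01 s1.
set g : R := _ + 1 / 2.
have g0 : 0 <= g by rewrite addr_ge0 ?divr_ge0.
have [c0 c00 Hc] := legendre_at1_bounds R r.
have r0' : 0 < r%:R :> R by rewrite ltr0n.
(* On the strip kr <= r(r + 3N) <= B0 N, which bounds the weights. *)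
pose B0 : R := (r * (r + 3))%:R.
have B00 : 0 < B0 by rewrite ltr0n muln_gt0 r1 addn_gt0 r1.
exists (2 `^ (- s^-1) * B0 `^ (- mu) * (c0 * (c0 * r%:R `^ g))).
  by rewrite !mulr_gt0 ?powR_gt0.
move=> delta N d0 N0; have N0' : 0 < N%:R :> R by rewrite ltr0n.
apply: le_ereal_inf_tmp => _ [W [_ ON] <-].
apply: le_ereal_inf_tmp => _ [psi _ <-].
(* There are 2N candidates, of which at most N lie in Omega; starting at r + N ensures k >= N. *)
pose I := index_iota (r + N) (r + 3 * N).
pose K := [seq k <- I | (k, r) \notin W].
have uK : uniq K by rewrite filter_uniq // iota_uniq.
have KI k : k \in K -> [/\ (r + N <= k)%N, (k < r + 3 * N)%N & (k, r) \notin W].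
  by rewrite mem_filter mem_index_iota => /and3P[-> -> ->].
have sI : size I = (2 * N)%N by rewrite size_iota subnDl -{2}[N]mul1n -mulnBl.
have NK : (N <= size K)%N.
  have : (size [seq k <- I | (k, r) \in W] <= N)%N.
    apply: leq_trans ON; rewrite -(size_map (fun k => (k, r))).
    apply: uniq_leq_size.
      by rewrite map_inj_uniq ?filter_uniq ?iota_uniq // => x y [].
    by move=> _ /mapP[k kI ->]; move: kI; rewrite mem_filter => /andP[].
  have := count_predC (fun k => (k, r) \in W) I.
  rewrite -!size_filter sI => E h.
  by rewrite -(leq_add2l N) addnn -mul2n -E leq_add2r.
have KN : (size K <= 2 * N)%N by rewrite -sI size_filter count_size.
(* Chosen so that 2N coefficients equal to c, with weights at most (B0 N)^mu, stay in the unit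
   ball. *)
pose c : R := (2 * N)%:R `^ (- s^-1) * (B0 * N%:R) `^ (- mu).
have N2 : 0 < (2 * N)%:R :> R by rewrite ltr0n muln_gt0.
have B1 : 0 < B0 * N%:R by rewrite mulr_gt0.
have c_gt0 : 0 < c by rewrite mulr_gt0 ?powR_gt0.
have cs : (size K)%:R * ((B0 * N%:R) `^ mu * c) `^ s <= 1.
  rewrite /c mulrCA -powR_addp // subrr powRr0 mulr1 -powRrM mulNr mulVf ?gt_eqF //.
  by rewrite powR_inv1 ?(ltW N2) // ler_pdivrMr // mul1r ler_nat.
have KB k : k \in K -> (maxn 1 (k * r))%:R <= B0 * N%:R.
  move=> /KI[_ kN _]; rewrite -natrM ler_nat geq_max.
  rewrite muln_gt0 N0 muln_gt0 r1 addn_gt0 r1 /=.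
  rewrite mulnC -mulnA leq_mul2l; apply/orP; right; apply: leq_trans (ltnW kN) _.
  by rewrite mulnDl leq_add2r leq_pmulr.
have Kr k : k \in K -> (r <= k)%N.
  by move=> /KI[h _ _]; apply: leq_trans h; exact: leq_addr.
have hs1 := smu_norm_strip (r := r) (c := c) s1 mu0 uK KB.
have hs2 := smu_norm_strip (r := r) (c := - c) s1 mu0 uK KB.
rewrite normrN in hs2; rewrite gtr0_norm // in hs1; rewrite gtr0_norm // in hs2.
have KW k : k \in K -> (k, r) \notin W by case/KI.
have H := recovery_error_strip psi p1 d0 uK Kr KW (hs1 cs) (hs2 cs).
apply: (le_trans _ H); rewrite lee_fin.
have low k : (r <= k)%N -> c0 * k%:R `^ g <= (legendre R k)^`(r).[1].
  by move=> rk; have /andP[] := Hc k (introT andP (conj r1 rk)).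
(* At least N terms, each of order N^g, times c of order N^(-1/s-mu), give the exponent. *)
apply: le_trans (_ : c * \sum_(k <- K) (c0 * N%:R `^ g * (c0 * r%:R `^ g)) <= _);
  last first.
  rewrite ler_pM2l // !big_seq; apply: ler_sum => k kK.
  have c1 := ltW c00.
  apply: ler_pM; rewrite ?mulr_ge0 ?powR_ge0 //; last exact: low.
  apply: le_trans (low _ (Kr _ kK)); rewrite ler_pM2l //.
  apply: powR_le => //; rewrite ler_nat; have [h _ _] := KI k kK.
  by apply: leq_trans h; exact: leq_addl.
rewrite big_const_seq count_predT iter_addr addr0 -[_ *+ size K]mulr_natr.
apply: le_trans (_ : c * (c0 * N%:R `^ g * (c0 * r%:R `^ g) * N%:R) <= _); last first.
  by rewrite ler_pM2l // ler_wpM2l ?ler_nat // !mulr_ge0 ?powR_ge0 // ltW.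
rewrite le_eqVlt; apply/orP; left; apply/eqP.
rewrite /c natrM !powRM ?ler0n // ?(ltW B00) //.
have -> : - (mu - g + 1 / s - 1) = - s^-1 + (- mu + (g + 1)) by ring.
by rewrite !powR_addp // powRr1 ?ler0n //; ring.
Qed.

Lemma truncation_recovery r n : @recovery_maps R (hyp_cross r n) (@truncation R r n).
Proof.
move=> y; apply: continuous_subspaceT; apply: continuous_big => [|w _ z].
  exact: add_continuous.
apply: cvgM; first exact: cvg_cst.
apply: cvgM; apply: continuous_comp; rewrite /=.
- exact: cvg_fst.
- exact: continuous_horner.
- exact: cvg_snd.
- exact: continuous_horner.
Qed.
End LowerBound.

(** * Relations between delta, N and n *)

Definition log_inv (R : realType) (delta : R) : R := ln (1 / delta).

(* The paper's N and n are of the order of rate beta e delta for e = mu and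
   e = 1/p - 1/s respectively. *)
Definition rate (R : realType) (beta e delta : R) : R :=
  (delta^-1 * log_inv delta `^ e) `^ (1 / beta).

Lemma powRN_scale_le (R : realType) (a c y x : R) : 0 <= a -> 0 < c -> 0 < y ->
  c * y <= x -> x `^ (- a) <= c `^ (- a) * y `^ (- a).
Proof.
move=> a0 c0 y0 h; have cy0 := mulr_gt0 c0 y0; have x0 := lt_le_trans cy0 h.
rewrite -powRM ?(ltW c0) ?(ltW y0) // !powRN lef_pV2 ?posrE ?powR_gt0 //.
by rewrite powR_le // ltW.
Qed.

Section Rates.
Variables (R : realType) (beta mu gam : R).
Hypotheses (beta0 : 0 < beta) (mu0 : 0 < mu) (muE : mu = gam + beta).
Hypothesis gam1 : -1 <= gam <= 1.
Implicit Types (delta x y : R) (N n : nat).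

Local Notation L := log_inv.
Local Notation rateN := (rate beta mu).
Local Notation raten := (rate beta gam).

Lemma log_inv_gt0 delta : 0 < delta < 1 -> 0 < L delta.
Proof.
by move=> /andP[d0 d1]; rewrite ln_gt0 // div1r invf_gt1.
Qed.

Lemma inv_expR delta : 0 < delta < 1 -> delta^-1 = expR (L delta).
Proof.
by move=> /andP[d0 d1]; rewrite lnK ?div1r // posrE invr_gt0.
Qed.

Lemma raten_gt0 delta : 0 < delta < 1 -> 0 < raten delta.
Proof.
move=> d; have l0 := log_inv_gt0 d; case/andP: d => d0 _.
by rewrite powR_gt0 // mulr_gt0 ?powR_gt0 ?invr_gt0.
Qed.

Lemma raten_beta delta : 0 < delta < 1 ->
  raten delta `^ beta = delta^-1 * L delta `^ gam.
Proof.
move=> d; have l0 := log_inv_gt0 d; case/andP: d => d0 _.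
rewrite -powRrM div1r mulVf ?gt_eqF // powRr1 //.
by rewrite mulr_ge0 ?powR_ge0 ?invr_ge0 ?(ltW d0).
Qed.

(** As mu = gam + beta, the rates differ by exactly one logarithm, the one in the number of points
    of a cross. *)
Lemma rateN_raten delta : 0 < delta < 1 -> rateN delta = raten delta * L delta.
Proof.
move=> d; have l0 := log_inv_gt0 d; have d0 : 0 < delta by case/andP: d.
rewrite /rate muE powR_addp // mulrA powRM ?mulr_ge0 ?powR_ge0 ?invr_ge0 ?(ltW d0) //.
by rewrite -[in X in _ * X]powRrM div1r mulfV ?gt_eqF // powRr1 // ltW.
Qed.

Lemma rateN_gt0 delta : 0 < delta < 1 -> 0 < rateN delta.
Proof. by move=> d; rewrite rateN_raten // mulr_gt0 ?raten_gt0 ?log_inv_gt0. Qed.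

(* Since N is an integer, N ~ rateN delta keeps delta away from 1. *)
Lemma log_inv_lower c1 c2 : 0 < c1 -> 0 < c2 ->
  exists2 l : R, 0 < l <= 1 & forall delta N, 0 < delta < 1 ->
    comparable_within c1 c2 N%:R (rateN delta) -> (0 < N)%N /\ l <= L delta.
Proof.
(* From 1 <= N <= c2 [rateN] follows e^L L^mu >= c2^(-beta); if L < 1, then e^L < e and L >= l. *)
move=> c10 c20; pose l : R := (c2 `^ (- beta) / expR 1) `^ mu^-1.
have l0 : 0 < l by rewrite powR_gt0 // divr_gt0 ?powR_gt0 ?expR_gt0.
exists (Num.min 1 l); first by rewrite lt_min ltr01 l0 ge_min lexx.
move=> delta N d /andP[h1 h2].
have L0 := log_inv_gt0 d.
have N0 : (0 < N)%N.
  by rewrite -(ltr0n R); apply: lt_le_trans h1; rewrite mulr_gt0 ?rateN_gt0.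
split => //; rewrite ge_min; have [//|L1] := leP 1 (L delta); apply/orP; right.
have : c2^-1 <= rateN delta.
  rewrite -div1r ler_pdivrMr // mulrC; apply: le_trans h2; by rewrite ler1n.
move=> /(powR_le (ltW beta0) _); rewrite invr_ge0 (ltW c20) => /(_ isT).
rewrite -powRrM div1r mulVf ?gt_eqF // powRr1; last first.
  by rewrite inv_expR // mulr_ge0 ?expR_ge0 ?powR_ge0.
rewrite inv_expR // -powR_inv1 ?(ltW c20) // -powRrM mulN1r => h.
have : c2 `^ (- beta) / expR 1 <= L delta `^ mu.
  rewrite ler_pdivrMr ?expR_gt0 // mulrC (le_trans h) // ler_wpM2r ?powR_ge0 //.
  by rewrite ler_expR ltW.
move=> /(@powR_le _ _ _ mu^-1) h'.
have {h'} := h' _ _; rewrite invr_ge0 (ltW mu0) divr_ge0 ?powR_ge0 ?expR_ge0 //.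
move=> /(_ isT isT); rewrite -/l -powRrM mulfV ?gt_eqF // powRr1 ?(ltW L0) //.
Qed.

Variable l : R.
Hypothesis l01 : 0 < l <= 1.

(** The power beta of [raten] is e^L L^gam. For L >= 1 it is at least e^L / L >= 1 since gam >= -1;
    for L < 1 it is at least L since gam <= 1. *)
Lemma raten_ge delta : 0 < delta < 1 -> l <= L delta -> l `^ (1 / beta) <= raten delta.
Proof.
move=> d lL; have L0 := log_inv_gt0 d; have /andP[l0 l1] := l01.
have /andP[g1 g2] := gam1.
apply: powR_le; rewrite ?divr_ge0 ?(ltW beta0) ?(ltW l0) //.
rewrite inv_expR //; have [L1|L1] := leP 1 (L delta).
  apply: le_trans l1 _.
  apply: le_trans (_ : expR (L delta) * (L delta) `^ (-1) <= _); last first.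
    by rewrite ler_wpM2l ?expR_ge0 // ler_powR.
  rewrite powR_inv1 ?(ltW L0) // ler_pdivlMr // mul1r.
  by apply: le_trans (expR_ge1Dx _); rewrite lerDr.
apply: le_trans lL _; apply: le_trans (_ : 1 * L delta `^ gam <= _).
  rewrite mul1r -[X in X <= _](powRr1 (ltW L0)).
  by apply: ger_powR; rewrite // L0 ltW.
by rewrite ler_wpM2r ?powR_ge0 // -expR0 ler_expR ltW.
Qed.

(** The logarithm is (L + gam ln L) / beta, and gam ln L is at most L for L >= 1, and at most 1/L <=
    L / l^2 for l <= L < 1. *)
Lemma ln_raten_le : exists2 C : R, 0 < C & forall delta, 0 < delta < 1 ->
  l <= L delta -> 1 + ln (raten delta) <= C * L delta.
Proof.
have /andP[l0 l1] := l01.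
have /andP[g1 g2] := gam1.
exists (l^-1 + beta^-1 * (1 + l^-1 ^+ 2)).
  by rewrite addr_gt0 ?invr_gt0 // mulr_gt0 ?addr_gt0 ?exprn_gt0 ?invr_gt0.
move=> delta d lL; have L0 := log_inv_gt0 d.
rewrite mulrDl lerD //.
  by rewrite mulrC ler_pdivlMr // mul1r.
rewrite ln_powR div1r -mulrA ler_pM2l ?invr_gt0 // inv_expR //.
rewrite lnM ?posrE ?expR_gt0 ?powR_gt0 // expRK mulrDl mul1r lerD2l ln_powR.
have [L1|L1] := leP 1 (L delta).
  apply: le_trans (_ : L delta <= _); last first.
    by rewrite ler_peMl ?(ltW L0) // exprn_ege1 // invf_ge1.
  apply: le_trans (_ : 1 * ln (L delta) <= _).
    by rewrite ler_wpM2r // ln_ge0.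
  by rewrite mul1r ltW // ln_sublinear.
have ln1 : - ln (L delta) <= (L delta)^-1.
  by rewrite -lnV ?posrE // ltW // ln_sublinear // invr_gt0.
have lneg : ln (L delta) <= 0 by rewrite ln_le0 // ltW.
apply: le_trans (_ : (L delta)^-1 <= _).
  by apply: le_trans ln1; rewrite -subr_ge0 -opprD oppr_ge0; nra.
rewrite -div1r ler_pdivrMr // -mulrA -expr2 exprVn mulrC ler_pdivlMr ?exprn_gt0 // mul1r.
by rewrite ler_sqr ?nnegrE // ltW.
Qed.

(** Taking logarithms and using ln L >= ln l gives L <= beta ln N + D; as N >= 2, the constant D is
    absorbed into a multiple of ln N. *)
Lemma log_inv_le_lnN c1 : 0 < c1 -> exists2 C : R, 0 < C & forall delta N,
  0 < delta < 1 -> l <= L delta -> (1 < N)%N -> c1 * rateN delta <= N%:R ->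
  L delta <= C * ln N%:R.
Proof.
move=> c10; have /andP[l0 l1] := l01.
pose D : R := beta * `|ln c1| + mu * `|ln l|.
have D0 : 0 <= D by rewrite addr_ge0 // mulr_ge0 // ltW.
have ln2 : 0 < ln 2 :> R by rewrite ln_gt0 // ltr1n.
exists (beta + D / ln 2); first by rewrite ltr_wpDr ?divr_ge0 // ltW.
move=> delta N d lL N1 h; have L0 := log_inv_gt0 d.
have lnN : ln 2 <= ln N%:R :> R by rewrite ler_ln ?posrE ?ltr0n ?ler_nat ?(ltnW N1).
have : ln (c1 * rateN delta) <= ln N%:R.
  by rewrite ler_ln ?posrE ?mulr_gt0 ?rateN_gt0 ?ltr0n ?(ltnW N1).
rewrite lnM ?posrE ?rateN_gt0 // /rate ln_powR (inv_expR d).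
rewrite [ln (expR _ * _)]lnM ?posrE ?expR_gt0 ?powR_gt0 //.
rewrite expRK [ln (_ `^ mu)]ln_powR div1r => h1.
have h2 : L delta + mu * ln (L delta) <= beta * (ln N%:R - ln c1).
  by rewrite -ler_pdivrMl // lerBrDl.
have h3 : ln l <= ln (L delta) by rewrite ler_ln ?posrE.
have h4 : mu * ln l <= mu * ln (L delta) by rewrite ler_pM2l.
have h5 : - (mu * `|ln l|) <= mu * ln l.
  by rewrite -mulrN ler_pM2l // lerNl ler_normr lexx orbT.
have h6 : - (beta * `|ln c1|) <= beta * ln c1.
  by rewrite -mulrN ler_pM2l // lerNl ler_normr lexx orbT.
have h7 : D <= D / ln 2 * ln N%:R.
  by rewrite -mulrA ler_peMr // mulrC ler_pdivlMr // mul1r.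
rewrite mulrDl; move: h2; rewrite mulrBr /D in h7 *; lra.
Qed.

Lemma rate_powN (e a delta : R) : 0 < delta < 1 ->
  (delta * L delta `^ (- e)) `^ (a / beta) = rate beta e delta `^ (- a).
Proof.
move=> d; have L0 := log_inv_gt0 d; have d0 : 0 < delta by case/andP: d.
have -> : delta * L delta `^ (- e) = (delta^-1 * L delta `^ e) `^ (-1).
  rewrite powR_inv1 ?mulr_ge0 ?invr_ge0 ?powR_ge0 ?(ltW d0) //.
  by rewrite invfM invrK powRN.
by rewrite /rate -!powRrM; congr powR; field; rewrite gt_eqF.
Qed.

(** If k, j >= r >= 1 then kj >= r. Level 1 is thus a free fallback in [exists_level]. *)
Lemma card_hyp_cross1 r : (0 < r)%N -> #|` hyp_cross r 1| = 0%N.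
Proof.
move=> r0; apply/eqP; rewrite cardfs_eq0; apply/eqP/fsetP => i.
rewrite mem_hyp_cross // muln1 in_fset0; apply/negbTE/negP => /and3P[h1 h2].
by rewrite ltnNge (leq_trans h1) // leq_pmulr // (leq_trans r0 h2).
Qed.

Lemma exists_level r c1 : (0 < r)%N -> 0 < c1 ->
  exists a1 a2 : R, [/\ 0 < a1, 0 < a2 & forall delta N, 0 < delta < 1 ->
    l <= L delta -> c1 * rateN delta <= N%:R ->
    exists n, comparable_within a1 a2 n%:R (raten delta)
              /\ (#|` hyp_cross r n| <= N)%N].
Proof.
move=> r0 c10; have [C C0 HC] := ln_raten_le; have /andP[l0 l1] := l01.
have r0' : 0 < r%:R :> R by rewrite ltr0n.
(* The first bound gives rn <= [raten], so that [ln_raten_le] controls the logarithm; the second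
   brings the number of points below c1 [rateN]. *)
pose a : R := Num.min r%:R^-1 (c1 / (r%:R * C)).
have a0 : 0 < a by rewrite lt_min invr_gt0 r0' divr_gt0 ?mulr_gt0.
have ar : a * r%:R <= 1 by rewrite -ler_pdivlMr // div1r ge_min lexx.
have ac : a * (r%:R * C) <= c1.
  by rewrite -ler_pdivlMr ?mulr_gt0 // ge_min lexx orbT.
have y0 : 0 < l `^ (1 / beta) by rewrite powR_gt0.
exists (a / 2), (a + (l `^ (1 / beta))^-1); split.
- by rewrite divr_gt0.
- by rewrite addr_gt0 ?invr_gt0.
move=> delta N d lL h; have Y0 := raten_gt0 d.
have aY0 : 0 <= a * raten delta by rewrite mulr_ge0 ?ltW.
set t := Num.truncn (a * raten delta).
have tY : t%:R <= a * raten delta by rewrite truncn_le.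
have tY' : a * raten delta < t.+1%:R by exact: truncnS_gt.
have y1 : 1 <= (l `^ (1 / beta))^-1 * raten delta.
  by rewrite ler_pdivlMl // mulr1; exact: raten_ge.
(* When the maximum is 1 the level is still comparable, because [raten_ge] keeps [raten] away from
   0. *)
exists (maxn 1 t); split.
  apply/andP; split.
    have : t.+1%:R <= 2 * (maxn 1 t)%:R :> R.
      by rewrite -natrM ler_nat mul2n -addnn -add1n leq_add ?leq_maxl ?leq_maxr.
    move=> h2; rewrite mulrAC ler_pdivrMr // [_ * 2]mulrC.
    exact: le_trans (ltW tY') h2.
  rewrite mulrDl; case: (leqP t 1) => [t1|t1].
    by apply: (le_trans y1); rewrite lerDr.
  by apply: (le_trans tY); rewrite lerDl; exact: le_trans y1.
case: (leqP t 1) => [t1|t1]; first by rewrite card_hyp_cross1.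
have t0 : 0 < t%:R :> R by rewrite ltr0n ltnW.
rewrite -(ler_nat R); apply: le_trans h.
apply: le_trans (card_hyp_cross_le R r0 (ltnW t1)) _.
have rt : (r * t)%:R <= raten delta.
  rewrite natrM; apply: le_trans (_ : r%:R * (a * raten delta) <= _).
    by rewrite ler_wpM2l.
  by rewrite mulrA ler_piMl ?(ltW Y0) // mulrC.
have lnrt : 1 + ln (r * t)%:R <= C * L delta.
  apply: le_trans (HC _ d lL); rewrite lerD2l ler_ln ?posrE //.
  by rewrite natrM mulr_gt0.
have L0 := log_inv_gt0 d.
apply: le_trans (_ : (r%:R * (a * raten delta)) * (C * L delta) <= _).
  apply: ler_pM => //; rewrite ?natrM ?ler_wpM2l //.
  by rewrite -natrM addr_ge0 // ln_ge0 // ler1n muln_gt0 r0 ltnW.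
rewrite rateN_raten //.
rewrite (_ : _ * _ = a * (r%:R * C) * (raten delta * L delta)); last by ring.
by rewrite ler_wpM2r // mulr_ge0 ?(ltW Y0) ?(ltW L0).
Qed.

(** With the base bounded below, raising the exponent costs only a constant. *)
Lemma powR_le_base (x y z : R) : l <= x -> y <= z -> x `^ y <= l `^ (y - z) * x `^ z.
Proof.
have /andP[l0 l1] := l01; move=> lx yz; have x0 := lt_le_trans l0 lx.
have -> : x `^ y = x `^ (y - z) * x `^ z by rewrite -powR_addp // subrK.
rewrite ler_wpM2r ?powR_ge0 //.
have -> : y - z = - (z - y) by ring.
rewrite !powRN lef_pV2 ?posrE ?powR_gt0 //.
by rewrite powR_le ?subr_ge0 // ltW.
Qed.

(* The bias (r n)^(-a) and the noise delta (r n)^(beta - a) balance up to the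
   factor L^gam. *)
Lemma balanced_error r (C a e a1 a2 : R) : (0 < r)%N -> 0 < C ->
  0 < a <= beta -> 0 <= e -> gam <= e -> 0 < a1 -> 0 < a2 ->
  exists2 B : R, 0 < B & forall delta n, 0 < delta < 1 -> l <= L delta ->
    comparable_within a1 a2 n%:R (raten delta) ->
    (0 < n)%N /\
    C * ((r * n)%:R `^ (- a) + delta * (r * n)%:R `^ (beta - a)) * (1 + ln (r * n)%:R)
    <= B * (raten delta `^ (- a) * L delta `^ (1 + e)).
Proof.
move=> r0 C0 /andP[a0 ab] e0 ge a10 a20.
have /andP[l0 l1] := l01; have [D D0 HD] := ln_raten_le.
have r0' : 0 < r%:R :> R by rewrite ltr0n.
pose H : R := D + `|ln (r%:R * a2)| / l.
have H0 : 0 < H by rewrite ltr_wpDr // divr_ge0 // ltW.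
(* The two summands belong to bias and noise, whose factors L^0 and L^gam are both raised to L^e. *)
pose G : R := a1 `^ (- a) * l `^ (0 - e) + (r%:R * a2) `^ (beta - a) * l `^ (gam - e).
have G0 : 0 < G by rewrite addr_gt0 ?mulr_gt0 ?powR_gt0 ?mulr_gt0.
exists (C * G * H); first by rewrite !mulr_gt0.
move=> delta n d lL /andP[n1 n2]; have Y0 := raten_gt0 d; have L0 := log_inv_gt0 d.
have n0 : (0 < n)%N by rewrite -(ltr0n R) (lt_le_trans _ n1) // mulr_gt0.
have d0 : 0 < delta by case/andP: d.
have n0' : 0 < n%:R :> R by rewrite ltr0n.
split => //.
have rn : (r * n)%:R <= (r%:R * a2) * raten delta by rewrite natrM -mulrA ler_wpM2l.
have rn0 : 0 < (r * n)%:R :> R by rewrite natrM mulr_gt0.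
have nr : a1 * raten delta <= (r * n)%:R.
  by apply: (le_trans n1); rewrite ler_nat leq_pmull.
have t1 : (r * n)%:R `^ (- a) <= a1 `^ (- a) * raten delta `^ (- a).
  exact: powRN_scale_le (ltW a0) _ _ nr.
have t2 : delta * (r * n)%:R `^ (beta - a)
    <= (r%:R * a2) `^ (beta - a) * (raten delta `^ (- a) * L delta `^ gam).
  apply: le_trans (_ : delta * ((r%:R * a2) * raten delta) `^ (beta - a) <= _).
    apply: ler_wpM2l (ltW d0) _ _ _; apply: powR_le rn; last exact: ltW.
    by rewrite subr_ge0.
  rewrite powRM ?mulr_ge0 ?(ltW a20) ?(ltW Y0) // mulrCA ler_wpM2l ?powR_ge0 //.
  (* The balance: delta times the power beta of [raten] is L^gam. *)
  rewrite powR_addp // raten_beta // -mulrA mulVKf ?gt_eqF // mulrC.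
  exact: lexx.
have t3 : 1 + ln (r * n)%:R <= H * L delta.
  have : ln (r * n)%:R <= ln (r%:R * a2) + ln (raten delta).
    by rewrite -lnM ?posrE ?mulr_gt0 // ler_ln ?posrE ?mulr_gt0.
  have := HD _ d lL; have := ler_norm (ln (r%:R * a2)).
  have : `|ln (r%:R * a2)| <= `|ln (r%:R * a2)| / l * L delta.
    by rewrite -mulrA ler_peMr // mulrC ler_pdivlMr // mul1r.
  rewrite /H mulrDl; move: (`|_|) (_ / l * _) => z1 z2; lra.
have t4 : (r * n)%:R `^ (- a) + delta * (r * n)%:R `^ (beta - a)
    <= G * (raten delta `^ (- a) * L delta `^ e).
  apply: (le_trans (lerD t1 t2)); rewrite mulrDl; apply: lerD.
    rewrite -!mulrA ler_wpM2l ?powR_ge0 // mulrCA ler_peMr ?powR_ge0 //.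
    by have := powR_le_base lL e0; rewrite powRr0.
  rewrite -!mulrA ler_wpM2l ?powR_ge0 // mulrCA ler_wpM2l ?powR_ge0 //.
  exact: powR_le_base.
apply: le_trans (_ :
  C * (G * (raten delta `^ (- a) * L delta `^ e)) * (H * L delta) <= _).
  apply: ler_pM t3.
  - by rewrite mulr_ge0 ?(ltW C0) // addr_ge0 ?mulr_ge0 ?powR_ge0 ?(ltW d0).
  - by rewrite addr_ge0 // ln_ge0 // ler1n muln_gt0 r0.
  - by rewrite ler_wpM2l // ltW.
rewrite [1 + e]addrC powR_addp // powRr1 ?(ltW L0) //.
by rewrite le_eqVlt; apply/orP; left; apply/eqP; ring.
Qed.

(** Since [raten] = [rateN] / L >= N / (c2 L), its power -a costs a factor L^a; then L is replaced
    by a multiple of ln N. *)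
Lemma raten_to_N (a w c1 c2 : R) : 0 < a -> 0 <= w -> 0 < c1 -> 0 < c2 ->
  exists2 B : R, 0 < B & forall delta N, 0 < delta < 1 -> l <= L delta ->
    comparable_within c1 c2 N%:R (rateN delta) -> (1 < N)%N ->
    raten delta `^ (- a) * L delta `^ w
    <= B * (N%:R `^ (- a) * ln N%:R `^ (a + w)).
Proof.
move=> a0 w0 c10 c20; have [D D0 HD] := log_inv_le_lnN c10.
exists (c2 `^ a * D `^ (a + w)); first by rewrite mulr_gt0 ?powR_gt0.
move=> delta N d lL /andP[h1 h2] N1; have Y0 := raten_gt0 d; have L0 := log_inv_gt0 d.
have N0 : 0 < N%:R :> R by rewrite ltr0n ltnW.
have lN : 0 < ln N%:R :> R by rewrite ln_gt0 // ltr1n.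
have : raten delta `^ (- a) <= c2 `^ a * L delta `^ a * N%:R `^ (- a).
  have k : (c2 * L delta)^-1 * N%:R <= raten delta.
    rewrite mulrC ler_pdivrMr ?mulr_gt0 // mulrC -mulrA [L _ * _]mulrC.
    by rewrite -rateN_raten.
  have k0 : 0 < (c2 * L delta)^-1 by rewrite invr_gt0 mulr_gt0.
  apply: le_trans (powRN_scale_le (ltW a0) k0 N0 k) _.
  rewrite -powR_inv1 ?mulr_ge0 ?(ltW c20) ?(ltW L0) // -powRrM mulN1r opprK.
  by rewrite powRM // ltW.
move=> h; apply: le_trans (_ :
  c2 `^ a * L delta `^ a * N%:R `^ (- a) * L delta `^ w <= _).
  by rewrite ler_wpM2r ?powR_ge0.
have -> : c2 `^ a * L delta `^ a * N%:R `^ (- a) * L delta `^ w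
   = c2 `^ a * (L delta `^ (a + w) * N%:R `^ (- a)).
  by rewrite powR_addp //; ring.
have lD : L delta `^ (a + w) <= D `^ (a + w) * ln N%:R `^ (a + w).
  rewrite -powRM ?(ltW D0) ?(ltW lN) //.
  apply: powR_le (HD _ _ d lL N1 h1); last exact: ltW.
  by rewrite addr_ge0 // ltW.
rewrite -mulrA; apply: ler_wpM2l; first exact: powR_ge0.
rewrite [N%:R `^ _ * _]mulrC mulrA.
by apply: ler_wpM2r lD; exact: powR_ge0.
Qed.

End Rates.

(** * Assembly of the two-sided estimates *)

Lemma fine_inv_ge0_le1 (R : realType) (p : \bar R) : (1 <= p)%E ->
  0 <= fine (p^-1)%E <= 1.
Proof.
case: p => [q| |] //= q1; last by rewrite lexx ler01.
rewrite lee_fin in q1; have q0 := lt_le_trans ltr01 q1.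
by rewrite inver gt_eqF //= invr_ge0 (ltW q0) invf_le1.
Qed.

Theorem theorem0p4p2 (R : realType) (r : nat) (s mu : R) (p : \bar R)
    (hr : (1 <= r)%N) (hs : 1 <= s)
    (hmu : 2 * r%:R - 1 / s + 3 / 2 < mu) (hp : (1 <= p)%E) :
  let ip : R := fine (p^-1)%E in
  let beta : R := mu - ip + 1 / s in
  let alpha : R := mu - 2 * r%:R + 1 / s - 3 / 2 in
  let L (delta : R) : R := ln (1 / delta) in
  let lowerN (N : nat) : R := N%:R `^ (- mu + 2 * r%:R - 1 / s + 3 / 2) in
  let upperN (N : nat) : R :=
    N%:R `^ (- mu + 2 * r%:R - 1 / s + 3 / 2)
    * (ln N%:R) `^ (mu - 2 * r%:R + 1 / 2) in
  let lowerd (delta : R) : R :=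
    (delta * L delta `^ (- mu)) `^ (alpha / beta) in
  let upperd (delta : R) : R :=
    (delta * L delta `^ (1 / s - ip)) `^ (alpha / beta)
    * L delta `^ (2 - 1 / s) in
  let rateN (delta : R) : R := (delta^-1 * L delta `^ mu) `^ (1 / beta) in
  let raten (delta : R) : R :=
    (delta^-1 * L delta `^ (ip - 1 / s)) `^ (1 / beta) in
  forall c1 c2 : R, 0 < c1 -> 0 < c2 ->
    (exists A B : R, 0 < A /\ 0 < B /\
      forall (delta : R) (N : nat), 0 < delta < 1 ->
        comparable_within c1 c2 N%:R (rateN delta) ->
        [/\ ((A * lowerN N)%:E <= min_radius r s mu p delta N)%E,
            (1 < N)%N -> (min_radius r s mu p delta N <= (B * upperN N)%:E)%E,
            ((A * lowerd delta)%:E <= min_radius r s mu p delta N)%E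
          & (min_radius r s mu p delta N <= (B * upperd delta)%:E)%E])
    /\
    (exists a1 a2 : R, 0 < a1 /\ 0 < a2 /\
      forall (delta : R) (N : nat), 0 < delta < 1 ->
        comparable_within c1 c2 N%:R (rateN delta) ->
        exists n : nat, comparable_within a1 a2 n%:R (raten delta)
                        /\ (#|` hyp_cross r n| <= N)%N)
    /\
    (forall a1 a2 : R, 0 < a1 -> 0 < a2 ->
      exists B : R, 0 < B /\
      forall (delta : R) (N n : nat), 0 < delta < 1 ->
        comparable_within c1 c2 N%:R (rateN delta) ->
        comparable_within a1 a2 n%:R (raten delta) ->
        ((1 < N)%N -> (recovery_error r s mu p delta (@truncation R r n)
                         <= (B * upperN N)%:E)%E)
        /\ (recovery_error r s mu p delta (@truncation R r n)
              <= (B * upperd delta)%:E)%E).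
Proof.
move=> ip beta alpha L lowerN upperN lowerd upperd rateN raten c1 c2 c10 c20.
have s0 := lt_le_trans ltr01 hs.
have /andP[ip0 ip1] : 0 <= ip <= 1 by exact: fine_inv_ge0_le1.
have sV1 : 1 / s <= 1 by rewrite div1r invf_le1.
have sV0 : 0 < 1 / s by rewrite div1r invr_gt0.
have r1 : 1 <= r%:R :> R by rewrite ler1n.
have mu0 : 0 < mu by move: hmu; lra.
have a0 : 0 < alpha by rewrite /alpha; move: hmu; lra.
have ab : alpha <= beta by rewrite /alpha /beta; lra.
have b0 : 0 < beta by exact: lt_le_trans ab.
pose gam := ip - 1 / s.
have muE : mu = gam + beta by rewrite /gam /beta; ring.
have gam1 : -1 <= gam <= 1 by rewrite /gam; apply/andP; split; lra.
(* The bias has exponent -alpha and the noise exponent beta - alpha. *)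
have aE : mu - ((2 * r)%:R + 1 / 2) + 1 / s - 1 = alpha.
  by rewrite /alpha natrM; field; rewrite gt_eqF.
have kE : (2 * r)%:R + 1 / 2 + 1 - ip = beta - alpha.
  by rewrite /alpha /beta natrM; field; rewrite gt_eqF.
have [l l01 Hl] := log_inv_lower b0 mu0 muE c10 c20.
have eN : - mu + 2 * r%:R - 1 / s + 3 / 2 = - alpha by rewrite /alpha; ring.
have trunc a1 a2 : 0 < a1 -> 0 < a2 -> exists B : R, 0 < B /\
    forall (delta : R) (N n : nat), 0 < delta < 1 ->
      comparable_within c1 c2 N%:R (rateN delta) ->
      comparable_within a1 a2 n%:R (raten delta) ->
      ((1 < N)%N -> (recovery_error r s mu p delta (@truncation R r n)
                       <= (B * upperN N)%:E)%E)
      /\ (recovery_error r s mu p delta (@truncation R r n)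
            <= (B * upperd delta)%:E)%E.
  move=> a10 a20.
  have aD : 0 < mu - ((2 * r)%:R + 1 / 2) + 1 / s - 1 by rewrite aE.
  have [C C0 HC] := truncation_error hr hs aD hp.
  (* Taking e = 1 - 1/s dominates gam = 1/p - 1/s for every p; the logarithm from the sums then
     gives the exponent 1 + e = 2 - 1/s. *)
  have e0 : 0 <= 1 - 1 / s by rewrite subr_ge0.
  have ge : gam <= 1 - 1 / s by rewrite /gam lerD2r.
  have [B1 B10 HB1] := balanced_error b0 gam1 l01 hr C0
    (introT andP (conj a0 ab)) e0 ge a10 a20.
  have w0 : 0 <= 1 + (1 - 1 / s) by rewrite addr_ge0.
  have [B2 B20 HB2] := raten_to_N b0 mu0 muE l01 a0 w0 c10 c20.
  exists (B1 + B1 * B2); split; first by rewrite addr_gt0 ?mulr_gt0.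
  move=> delta N n d cN cn.
  have [N0 lL] := Hl delta N d cN; have [n0 En] := HB1 delta n d lL cn.
  have d0 : 0 < delta by case/andP: d.
  have err : (recovery_error r s mu p delta (@truncation R r n)
      <= (B1 * (rate beta gam delta `^ (- alpha)
                * log_inv delta `^ (1 + (1 - 1 / s))))%:E)%E.
    by apply: le_trans (HC n delta n0 d0) _; rewrite lee_fin -/ip aE kE.
  split => [N1|]; apply: (le_trans err); rewrite lee_fin.
    have := HB2 delta N d lL cN N1.
    rewrite /upperN eN; have -> : mu - 2 * r%:R + 1 / 2 = alpha + (1 + (1 - 1 / s)).
      by rewrite /alpha; field; rewrite gt_eqF.
    move=> h; rewrite mulrDl; apply: le_trans (_ : B1 * B2 * (N%:R `^ (- alpha)
       * ln N%:R `^ (alpha + (1 + (1 - 1 / s)))) <= _); last first.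
      by rewrite lerDr mulr_ge0 ?mulr_ge0 ?powR_ge0 // ltW.
    by rewrite -mulrA ler_pM2l.
  have -> : upperd delta
      = rate beta gam delta `^ (- alpha) * log_inv delta `^ (1 + (1 - 1 / s)).
    rewrite -(rate_powN b0 _ _ d) /upperd /gam opprB; congr (_ * _ `^ _).
    by field; rewrite gt_eqF.
  by rewrite mulrDl lerDl mulr_ge0 ?mulr_ge0 ?powR_ge0 // ltW.
have [a1 [a2 [a10 a20 lev]]] := exists_level b0 muE gam1 l01 hr c10.
have lev' (delta : R) (N : nat) : 0 < delta < 1 ->
    comparable_within c1 c2 N%:R (rateN delta) ->
    exists n : nat, comparable_within a1 a2 n%:R (raten delta)
                    /\ (#|` hyp_cross r n| <= N)%N.
  move=> d cN; have [_ lL] := Hl delta N d cN.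
  by case/andP: cN => cN _; exact: lev lL cN.
split; last by split; [exists a1, a2 | exact: trunc].
have [B [B0 HB]] := trunc a1 a2 a10 a20.
have [A A0 HA] := min_radius_lower hr hs (ltW mu0) hp.
(* The second entry serves the bound in delta, where N <= c2 [rateN] turns the power of N into one
   of the rate. *)
exists (Num.min A (A * c2 `^ (- alpha))), B; split; [|split => //].
  by rewrite lt_min A0 mulr_gt0 ?powR_gt0.
move=> delta N d cN; have [N0 lL] := Hl delta N d cN.
have d0 : 0 < delta by case/andP: d.
have N0' : 0 < N%:R :> R by rewrite ltr0n.
have low := HA delta N d0 N0; rewrite aE in low.
have [n [cn card_n]] := lev' delta N d cN.
have [HB1 HB2] := HB delta N n d cN cn.
(* The cross of level n has at most N points, so the truncation competes in both infima. *)
have inf : (min_radius r s mu p delta N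
    <= recovery_error r s mu p delta (@truncation R r n))%E.
  apply: (@le_trans _ _ (ereal_inf [set recovery_error r s mu p delta psi
      | psi in @recovery_maps R (hyp_cross r n)]%classic)).
    apply: ereal_inf_lbound; exists (hyp_cross r n) => //; split => // i.
    by rewrite mem_hyp_cross // => /and3P[-> ->].
  apply: ereal_inf_lbound; exists (@truncation R r n) => //.
  exact: truncation_recovery.
split.
- apply: le_trans low; rewrite lee_fin /lowerN eN ler_wpM2r ?powR_ge0 //.
  by rewrite ge_min lexx.
- by move=> N1; apply: le_trans inf (HB1 N1).
- apply: le_trans low; rewrite lee_fin.
  have -> : lowerd delta = rate beta mu delta `^ (- alpha).
    by rewrite -(rate_powN b0 _ _ d).
  have [_ cN2] := andP cN.
  have h : c2^-1 * N%:R <= rate beta mu delta by rewrite ler_pdivrMl.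
  have h2 : rate beta mu delta `^ (- alpha) <= c2 `^ alpha * N%:R `^ (- alpha).
    have := powRN_scale_le (ltW a0) _ N0' h; rewrite invr_gt0 => /(_ c20).
    by rewrite -powR_inv1 ?(ltW c20) // -powRrM mulN1r opprK.
  apply: le_trans (_ : A * c2 `^ (- alpha) * rate beta mu delta `^ (- alpha) <= _).
    by rewrite ler_wpM2r ?powR_ge0 // ge_min lexx orbT.
  apply: le_trans (_ : A * c2 `^ (- alpha) * (c2 `^ alpha * N%:R `^ (- alpha)) <= _).
    by rewrite ler_wpM2l // mulr_ge0 ?powR_ge0 // ltW.
  by rewrite mulrA -[A * _ * _]mulrA -powR_addp // addNr powRr0 mulr1.
- exact: le_trans inf HB2.
Qed.
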